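(* Let $M$ be a viscoelastic model represented by a spring-dashpot network with $N$ springs (moduli $E_1,\dots,E_N$) and $K$ dashpots (viscosities $\eta_1,\dots,\eta_K$). Then $M$ is locally identifiable if and only if the number $d$ of non-monic coefficients of its normalized constitutive equation equals $N+K$, the total number of its moduli $E_j$ and viscosity parameters $\eta_k$.
   Context: Spring-dashpot networks. A spring with constant $E$ (relation $E\epsilon=\sigma$ between strain $\epsilon$ and stress $\sigma$) and a dashpot with constant $\eta$ (relation $\eta\dot\epsilon=\sigma$) are networks (the basic elements). If $N_1,N_2$ are networks with disjoint sets of parameters, their parallel connection $N_1\lor N_2$ and series connection $N_1\land N_2$ are networks; all networks arise in this way. The operations $\lor$ and $\land$ are each regarded as commutative and associative. Constitutive equation. Each network has a constitutive equation $L\epsilon=L'\sigma$, where $L,L'$ are linear differential operators, viewed as polynomials in $x=d/dt$, whose coefficients are functions of the parameters $E_j,\eta_k$. For basic elements it is given above. If $N_1,N_2$ have constitutive equations $L_1\epsilon_1=L_2\sigma_1$ and $L_3\epsilon_2=L_4\sigma_2$, then $N_1\land N_2$ has constitutive equation $L_1L_3\epsilon=(L_1L_4+L_2L_3)\sigma$ divided by $\gcd(L_1,L_3)$ (stresses equal, strains add), and $N_1\lor N_2$ has constitutive equation $(L_1L_4+L_2L_3)\epsilon=L_2L_4\sigma$ divided by $\gcd(L_2,L_4)$ (strains equal, stresses add). Parameters are treated as independent indeterminates, so gcds are taken over the field of rational functions in the parameters, and a coefficient is nonzero if it is not identically zero. The equation is normalized by dividing through so that the leading coefficient on one chosen side ($\epsilon$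 or $\sigma$) equals $1$. The non-monic coefficients are the remaining nonzero coefficients on both sides; $d$ is their number, and $\mathbf c$ is the vector of them. Identifiability. With parameter space $\Theta=\mathbb R_{>0}^{N+K}$, regard $\mathbf c$ as a map $\mathbf c:\Theta\to\mathbb R^d$. The model is globally identifiable if $\mathbf c$ is one-to-one, locally identifiable if $\mathbf c$ is finite-to-one, and unidentifiable if $\mathbf c$ is infinite-to-one. These notions are meant generically: for almost every $\theta\in\Theta$ the fiber $\mathbf c^{-1}(\mathbf c(\theta))$ is, respectively, a single point, finite, infinite. *)

(* Defs.v *)
From HB Require Import structures.
From mathcomp Require Import all_boot all_order all_algebra.
From mathcomp Require Import all_classical all_reals all_analysis.
From mathcomp Require mpoly.
(* The notations of mpoly clash with those of analysis; its canonical structures are needed. *)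
Import -(notations) mpoly.

Set Implicit Arguments.
Unset Strict Implicit.
Unset Printing Implicit Defensive.

Import Order.TTheory GRing.Theory Num.Theory.

Local Open Scope classical_set_scope.
Local Open Scope ring_scope.

(* Connection trees whose elements carry parameters among E_0 .. E_(N-1) and
   eta_0 .. eta_(K-1).  Commutativity and associativity of the connections are
   not built in: statements range over all trees, hence over all presentations
   of a network, and the normalized constitutive equation is the same for all
   of them. *)
Inductive tree (N K : nat) : Type :=
| Spring of 'I_N
| Dashpot of 'I_K
| Parallel of tree N K & tree N K
| Series of tree N K & tree N K.

Fixpoint params N K (M : tree N K) : seq ('I_N + 'I_K) :=
  match M with
  | Spring j => [:: inl j]
  | Dashpot k => [:: inr k]
  | Parallel M1 M2 | Series M1 M2 => params M1 ++ params M2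
  end.

Fixpoint is_network N K (M : tree N K) : bool :=
  match M with
  | Spring _ | Dashpot _ => true
  | Parallel M1 M2 | Series M1 M2 =>
      [&& is_network M1, is_network M2 & ~~ has (mem (params M1)) (params M2)]
  end.

(* No parameter is repeated (is_network) and every one occurs, so there are
   exactly N springs and K dashpots. *)
Definition network_with N K (M : tree N K) : Prop :=
  is_network M /\ forall p : 'I_N + 'I_K, p \in params M.

Section ConstitutiveEquation.
Variables (R : realType) (N K : nat).

Definition ratfun : fieldType := {fraction (mpoly (N + K) R)}.

Definition indet (i : 'I_(N + K)) : ratfun :=
  tofrac (mpolyX R (mnm1 i) : mpoly (N + K) R).

(* (L, L') stands for the equation L epsilon = L' sigma, with 'X = d/dt.  The
   value of gcdp is fixed only up to a nonzero scalar, so the equation is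
   meaningful up to a scalar common to both sides, which normalization
   removes. *)
Fixpoint constitutive (M : tree N K) : {poly ratfun} * {poly ratfun} :=
  match M with
  | Spring j => ((indet (lshift K j))%:P, 1)
  | Dashpot k => (indet (rshift N k) *: 'X, 1)
  | Parallel M1 M2 =>
      let: (L1, L2) := constitutive M1 in
      let: (L3, L4) := constitutive M2 in
      let g := gcdp L2 L4 in
      ((L1 * L4 + L2 * L3) %/ g, (L2 * L4) %/ g)
  | Series M1 M2 =>
      let: (L1, L2) := constitutive M1 in
      let: (L3, L4) := constitutive M2 in
      let g := gcdp L1 L3 in
      ((L1 * L3) %/ g, (L1 * L4 + L2 * L3) %/ g)
  end.

Inductive side : Type := Strain | Stress.

Definition normalized (s : side) (M : tree N K) :
    {poly ratfun} * {poly ratfun} :=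
  let: (L, L') := constitutive M in
  let a := match s with Strain => lead_coef L | Stress => lead_coef L' end in
  (a^-1 *: L, a^-1 *: L').

Definition lower_coefs (p : {poly ratfun}) : seq ratfun := take (size p).-1 p.

Definition nonmonic_coefs (s : side) (M : tree N K) : seq ratfun :=
  let: (L, L') := normalized s M in
  [seq a <- match s with
            | Strain => lower_coefs L ++ (L' : seq ratfun)
            | Stress => (L : seq ratfun) ++ lower_coefs L'
            end | a != 0].

Definition num_nonmonic (s : side) (M : tree N K) : nat :=
  size (nonmonic_coefs s M).

(* Value of a rational function at theta: p(theta) / q(theta) for any fraction
   p / q representing it with q(theta) != 0 (see ratfun_evalE); 0 if there is
   no such fraction. *)
Definition ratfun_eval (f : ratfun) (theta : 'rV[R]_(N + K)) : R :=
  xget 0 [set v | exists p q : mpoly (N + K) R,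
    [/\ meval (theta 0) q != 0, f = tofrac p / tofrac q
      & v = meval (theta 0) p / meval (theta 0) q]].

Lemma ratfun_evalE (p q : mpoly (N + K) R) (theta : 'rV[R]_(N + K)) :
  meval (theta 0) q != 0 ->
  ratfun_eval (tofrac p / tofrac q) theta =
    meval (theta 0) p / meval (theta 0) q.
Proof.
move=> hq; rewrite /ratfun_eval.
have nz (r : mpoly (N + K) R) : meval (theta 0) r != 0 -> tofrac r != 0 :> ratfun.
  by move=> hr; rewrite tofrac_eq0; apply: contraNneq hr => ->; rewrite meval0.
case: xgetP => [v _ [p' [q' [hq' e ->]]]|/(_ (meval (theta 0) p / meval (theta 0) q))].
  move/eqP: e; rewrite eqr_div ?nz// -!tofracM tofrac_eq => /eqP e.
  by apply/eqP; rewrite eqr_div// -!mevalM e.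
by case; exists p, q.
Qed.

Definition param_space : set 'rV[R]_(N + K) :=
  [set theta | forall i, 0 < theta 0 i].

Definition coef_map (s : side) (M : tree N K) (theta : 'rV[R]_(N + K)) :
    'rV[R]_(num_nonmonic s M) :=
  \row_i ratfun_eval (nth 0 (nonmonic_coefs s M) i) theta.

Definition fiber (s : side) (M : tree N K) (theta : 'rV[R]_(N + K)) :
    set 'rV[R]_(N + K) :=
  [set theta' | param_space theta' /\ coef_map s M theta' = coef_map s M theta].

End ConstitutiveEquation.

(* A has Lebesgue measure zero in R^n: it is covered by countably many boxes of
   arbitrarily small total volume. *)
Definition lebesgue_null (R : realType) n (A : set 'rV[R]_n) : Prop :=
  forall e : R, 0 < e -> exists a b : nat -> 'rV[R]_n,
    [/\ forall k i, a k 0 i <= b k 0 i,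
        A `<=` \bigcup_k [set x : 'rV[R]_n | forall i, a k 0 i <= x 0 i <= b k 0 i]
      & (\sum_(0 <= k <oo) (\prod_(i < n) (b k 0 i - a k 0 i))%:E <= e%:E)%E].

Definition locally_identifiable (R : realType) N K (s : side)
    (M : tree N K) : Prop :=
  lebesgue_null
    [set theta : 'rV[R]_(N + K) |
      param_space theta /\ ~ finite_set (fiber s M theta)].

(* Main.v *)
(* Factor the strain polynomial as X^a A, with A(0) <> 0 and a = 0 or 1, and let
   B be the stress polynomial.  For positive parameters all coefficients of A and
   B are positive, so there are deg A + deg B + 1 non-monic coefficients, and the
   fibers of the coefficient map are the sets where (A, B) is fixed up to scale.
   Both connections act on (A, B) or (B, A) by one bilinear map
     (p1, q1), (p2, q2) |-> (p1 p2, X^al p1 q2 + X^be q1 p2),  al * be = 0,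
   with al + deg p1 <= deg q1 + 1 and be + deg p2 <= deg q2 + 1.  The number of
   coefficients is subadditive along this map, and additive exactly when one of
   these inequalities is an equality.

   Off the zero set of a product of resultants, which is Lebesgue null, all the
   relevant polynomials are coprime.  If every connection is additive, p1 is
   determined up to finitely many choices as a divisor of p1 p2, and then q1 and
   q2 are determined by coprimality and degrees, so that fibers are finite.  At a
   connection that is not additive, q1 + e X^al p1 and q2 - e X^be p2 give the
   same equation for all small e, and these pairs are realized by positive
   parameters because the coefficient map is open (Banach fixed point theorem
   applied to the bilinear map at each connection), so that the fiber is
   infinite. *)
From HB Require Import structures.
Require Import Defs.
From mathcomp Require Import all_boot all_order all_algebra.
From mathcomp Require Import all_classical all_reals all_analysis.
From mathcomp Require Import measurable_realfun.
From mathcomp Require Import complex polyrcf.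
From mathcomp Require Import ring lra zify.
From mathcomp Require mpoly.
Import -(notations) mpoly.

Set Implicit Arguments.
Unset Strict Implicit.
Unset Printing Implicit Defensive.

Import Order.TTheory GRing.Theory Num.Theory.
Import numFieldNormedType.Exports.

Local Open Scope classical_set_scope.
Local Open Scope ring_scope.

(** * Lebesgue null sets *)

Section Null.
Variable R : realType.

(* The weights make the induction on the dimension work: slicing at a value of
   the last coordinate restricts the weights to the boxes that are met. *)
Lemma weighted_cube_cover (n : nat) (a b : nat -> nat -> R) (w : nat -> R) :
  (forall k, 0 <= w k) -> (forall k i, a k i <= b k i) ->
  (forall x : nat -> R, (forall i, (i < n)%N -> 1 <= x i <= 2) ->
    (1 <= \sum_(0 <= k <oo)
       (w k * \prod_(i < n) \1_(`[a k i, b k i]) (x i))%:E)%E) ->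
  (1 <= \sum_(0 <= k <oo) (w k * \prod_(i < n) (b k i - a k i))%:E)%E.
Proof.
elim: n w => [|n IHn] w w0 ab cover.
  apply: le_trans (cover (fun=> 1) _) _ => //.
  by apply: lee_nneseries => [k _ _|k _]; rewrite ?lee_fin ?big_ord0 ?mulr1.
have p0 k : 0 <= \prod_(i < n) (b k i - a k i).
  by apply: prodr_ge0 => i _; rewrite subr_ge0.
pose f k (t : R) : \bar R :=
  ((w k * \prod_(i < n) (b k i - a k i))%:E * (\1_(`[a k n, b k n]) t)%:E)%E.
have slice (t : R) : 1 <= t <= 2 -> (1 <= \sum_(0 <= k <oo) f k t)%E.
  move=> t12; pose w' k := w k * \1_(`[a k n, b k n]) t.
  have -> : (\sum_(0 <= k <oo) f k t =
            \sum_(0 <= k <oo) (w' k * \prod_(i < n) (b k i - a k i))%:E)%E.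
    by apply: eq_eseriesr => k _; rewrite /f /w' -EFinM mulrAC.
  apply: IHn => // [k|x x12]; first by rewrite mulr_ge0.
  have -> : (\sum_(0 <= k <oo)
        (w' k * \prod_(i < n) \1_(`[a k i, b k i]) (x i))%:E =
      \sum_(0 <= k <oo) (w k * \prod_(i < n.+1) \1_(`[a k i, b k i])
       (if i == n :> nat then t else x i))%:E)%E.
    apply: eq_eseriesr => k _; rewrite big_ord_recr /= eqxx.
    rewrite /w' mulrA mulrAC; congr (_ * _ * _)%:E.
    by apply: eq_bigr => i _; rewrite ltn_eqF.
  apply: (cover (fun i => if i == n then t else x i)) => i.
  by rewrite ltnS leq_eqVlt; case: eqP => //= _; apply: x12.
have mD : measurable (`[1, 2] : set R) by exact: measurable_itv.
have f0 k t : (0 <= f k t)%E by rewrite mule_ge0 ?lee_fin ?mulr_ge0.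
have mf k : measurable_fun (`[1, 2] : set R) (f k).
  by apply/measurable_EFinP; apply: measurable_funM => //; exact: measurable_indic.
have Lf k : (\int[lebesgue_measure]_(t in `[1%R, 2%R]) f k t <=
    (w k * \prod_(i < n.+1) (b k i - a k i))%:E)%E.
  rewrite /f ge0_integralZl_EFin//; first last.
  - by rewrite mulr_ge0.
  - by apply/measurable_EFinP; exact: measurable_indic.
  rewrite integral_indic// big_ord_recr/= mulrA [leRHS]EFinM.
  apply: lee_wpmul2l; first by rewrite lee_fin mulr_ge0.
  apply: (@le_trans _ _ (lebesgue_measure (`[a k n, b k n] : set R))).
    by apply: le_measure; rewrite ?inE//; exact: measurableI.
  by rewrite lebesgue_measure_itv/=; case: ifP => // _; rewrite lee_fin subr_ge0.
(* Integrating [slice] over t in [1, 2] leaves 1 on the left. Sum and integral are exchanged by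
   monotone convergence, and [Lf] bounds each term. *)
apply: le_trans (lee_nneseries _ (fun k _ => Lf k)); last first.
  by move=> k _ _; exact: integral_ge0.
rewrite -integral_nneseries//.
apply: (@le_trans _ _ (\int[lebesgue_measure]_(t in `[1%R, 2%R]) cst 1%E t)%E).
  have := @lebesgue_measure_itv R `[1, 2].
  rewrite integral_cst// mul1e /= => ->; rewrite lte_fin.
  by rewrite ltr1n -EFinB lee_fin; lra.
apply: ge0_le_integral => //.
- by apply: (@ge0_emeasurable_sum _ _ _ _ f xpredT) => *.
Qed.

(** Boxes covering [1, 2]^n have total volume at least 1, by [weighted_cube_cover] with all weights
    1, so total volume 1/2 is impossible. The cube lies in the positive orthant, where the
    parameters live. *)
Lemma cube_not_null (n : nat) (A : set 'rV[R]_n) :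
  [set x : 'rV[R]_n | forall i, 1 <= x 0 i <= 2] `<=` A -> ~ lebesgue_null A.
Proof.
move=> cubeA /(_ (2^-1) _)[|a [b [ab Acov vol]]]; first by rewrite invr_gt0.
pose ext (c : nat -> 'rV[R]_n) k i := if insub i is Some j then c k 0 j else 0.
have extE c k (i : 'I_n) : ext c k i = c k 0 i by rewrite /ext valK.
have := @weighted_cube_cover n (ext a) (ext b) (fun=> 1).
suff h P : (1 <= P)%E -> (P <= (2^-1 : R)%:E)%E -> False.
  apply/not_implyP; split => //; apply/not_implyP; split.
    by move=> k i; rewrite /ext; case: insubP.
  apply/not_implyP; split.
    move=> x x12; have [k _ xk] : (\bigcup_k [set y : 'rV[R]_n |
        forall i, a k 0 i <= y 0 i <= b k 0 i]) (\row_i x i).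
      by apply/Acov/cubeA => i; rewrite mxE; exact: x12.
    rewrite (@nneseriesD1 _ _ k)//; last first.
      by move=> j _; rewrite lee_fin mul1r prodr_ge0.
    rewrite -[leLHS]adde0; apply: leeD; last first.
      by apply: nneseries_ge0 => j _ _; rewrite lee_fin mul1r prodr_ge0.
    rewrite lee_fin mul1r big1// => i _; rewrite indicE mem_set//=.
    by rewrite in_itv/= !extE; have := xk i; rewrite mxE.
  move/h; apply; apply: le_trans vol; rewrite le_eqVlt; apply/orP; left; apply/eqP.
  apply: eq_eseriesr => k _; rewrite mul1r; congr _%:E.
  by apply: eq_bigr => i _; rewrite !extE.
by move=> P1 /(le_trans P1); rewrite lee_fin; lra.
Qed.

(** The k-th set is covered with volume at most e / 2^(k+1), and the boxes of all covers are
    enumerated through a bijection of [nat] with [nat * nat]. *)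
Lemma null_bigcup (n : nat) (A : nat -> set 'rV[R]_n) :
  (forall k, lebesgue_null (A k)) -> lebesgue_null (\bigcup_k A k).
Proof.
move=> nullA e e0.
have ek0 k : 0 < e / (2 ^ k.+1)%:R by rewrite divr_gt0// ltr0n expn_gt0.
have /choice[a] k := nullA k _ (ek0 k); move=> /choice[b ab].
pose vol (k : nat * nat) := (\prod_(i < n) (b k.1 k.2 0 i - a k.1 k.2 0 i))%:E.
have vol0 k : (0 <= vol k)%E.
  rewrite lee_fin; apply: prodr_ge0 => i _; rewrite subr_ge0.
  by have [/(_ k.2 i)] := ab k.1.
have /card_esym/ppcard_eqP[f] := card_nat2.
exists (fun m => a (f m).1 (f m).2), (fun m => b (f m).1 (f m).2); split.
- by move=> m i; have [] := ab (f m).1.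
- move=> x [k _ Akx]; have [_ /(_ x Akx)[j _ xj] _] := ab k.
  by exists (f^-1%FUN (k, j)) => //=; rewrite invK ?inE.
- rewrite -[leLHS]/(\sum_(0 <= m <oo) vol (f m))%E nneseries_esumT//.
  rewrite -(@reindex_esum _ _ _ [set: nat] [set: nat * nat] f vol)//.
  rewrite [X in \esum_(_ in X) _](_ : _ = [set: nat] `*`` (fun=> [set: nat])).
    rewrite -(@esum_esum _ _ _ _ _ (fun i j => vol (i, j)))//.
    rewrite -nneseries_esumT; last by move=> k; exact: esum_ge0.
    apply: le_trans (epsilon_trick0 xpredT (ltW e0)).
    apply: lee_nneseries => [k _ _|k _]; first exact: esum_ge0.
    by rewrite -nneseries_esumT//; have [] := ab k.
  by apply/seteqP; split.
Qed.

Lemma sub_null (n : nat) (A B : set 'rV[R]_n) :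
  A `<=` B -> lebesgue_null B -> lebesgue_null A.
Proof.
move=> AB nullB e /nullB[a [b [ab cov vol]]]; exists a, b; split => //.
exact: subset_trans cov.
Qed.

(** The finite cover is padded to a sequence by the one-point box at 0. Its volume is 0 only in
    positive dimension: in dimension 0 the empty product is 1. *)
Lemma null_finite_cover (n : nat) (A : set 'rV[R]_n.+1) :
  (forall e : R, 0 < e -> exists (T : finType) (a b : T -> 'rV[R]_n.+1),
    [/\ forall t i, a t 0 i <= b t 0 i,
        A `<=` \bigcup_t [set x | forall i, a t 0 i <= x 0 i <= b t 0 i]
      & \sum_t \prod_(i < n.+1) (b t 0 i - a t 0 i) <= e]) ->
  lebesgue_null A.
Proof.
move=> cov e /cov[T [a [b [ab Acov vol]]]].
pose ext (c : T -> 'rV[R]_n.+1) k :=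
  if insub k is Some j then c (enum_val (j : 'I_#|T|)) else 0.
have extE c (j : 'I_#|T|) : ext c j = c (enum_val j) by rewrite /ext valK.
exists (ext a), (ext b); split.
- by move=> k i; rewrite /ext; case: insubP.
- move=> x /Acov[t _ xt]; exists (enum_rank t) => //=.
  by rewrite !extE enum_rankK.
- rewrite (nneseries_split 0 #|T|); last first.
    move=> k _; rewrite lee_fin prodr_ge0// => i _.
    by rewrite /ext; case: insubP => [j _ _|_]; rewrite subr_ge0.
  rewrite [X in (_ + X)%E]eseries0 ?adde0; last first.
    move=> k kT _; rewrite /ext insubF ?ltnNge ?kT//.
    by rewrite big_ord_recl mxE subrr mul0r.
  rewrite add0n big_mkord sumEFin lee_fin; apply: le_trans vol.
  rewrite (reindex (@enum_val T T))/=; last exact/onW_bij/enum_val_bij.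
  by under eq_bigr do rewrite !extE.
Qed.

Lemma null_bigcup_countable (n : nat) (T : countType) (A : T -> set 'rV[R]_n.+1) :
  (forall t, lebesgue_null (A t)) -> lebesgue_null (\bigcup_t A t).
Proof.
move=> nullA; apply: (@sub_null _ _ (\bigcup_k
    (if unpickle k is Some t then A t else set0))).
  by move=> x [t _ At]; exists (pickle t) => //; rewrite pickleK.
apply: null_bigcup => k; case: unpickle => [t|]; first exact: nullA.
apply: null_finite_cover => e e0.
by exists 'I_0, (fun=> 0), (fun=> 0); split => //; rewrite big_ord0 ltW.
Qed.

Lemma lebesgue_nullU (n : nat) (A B : set 'rV[R]_n) : (0 < n)%N ->
  lebesgue_null A -> lebesgue_null B -> lebesgue_null (A `|` B).
Proof.
case: n A B => // n A B _ nullA nullB.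
apply: (@sub_null _ _ (\bigcup_(b : bool) if b then A else B)).
  by move=> x [Ax|Bx]; [exists true | exists false].
by apply: null_bigcup_countable => -[].
Qed.

(** The coordinates other than i are cut into (m+1)^n columns of width h = l / (m+1). Over each
    column the Lipschitz bound confines Z to height 2 C h, and the total volume 2 C l^(n+1) / (m+1)
    tends to 0. *)
Lemma null_graph (n : nat) (i : 'I_n.+1) (Z : set 'rV[R]_n.+1) (c : 'rV[R]_n.+1)
    (l C : R) : 0 < l -> 0 <= C ->
  (forall x, Z x -> forall j, c 0 j <= x 0 j < c 0 j + l) ->
  (forall x y d, Z x -> Z y -> 0 <= d -> (forall j, j != i -> `|x 0 j - y 0 j| <= d) ->
     `|x 0 i - y 0 i| <= C * d) ->
  lebesgue_null Z.
Proof.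
move=> l0 C0 Zcube Zgraph; apply: null_finite_cover => e e0.
(* The choice m + 1 > V makes that total volume smaller than e. *)
pose V := C * l ^+ n.+1 *+ 2 / e.
have V0 : 0 <= V by rewrite /V divr_ge0 ?mulrn_wge0 ?mulr_ge0 ?exprn_ge0// ltW.
pose m := Num.truncn V; pose h := l / m.+1%:R.
have h0 : 0 < h by rewrite divr_gt0.
have Ch0 : 0 <= C * h by rewrite mulr_ge0// ltW.
pose column (g : {ffun 'I_n -> 'I_m.+1}) := [set x : 'rV[R]_n.+1 | Z x /\
  forall j, c 0 (lift i j) + (g j)%:R * h <= x 0 (lift i j)
            <= c 0 (lift i j) + (g j)%:R * h + h].
(* A reference point of Z in the column; the default 0 occurs only for a column that Z does not
   meet, whose box has nothing to cover. *)
pose z g := xget 0 (column g).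
pose box (u s : R) (g : {ffun 'I_n -> 'I_m.+1}) : 'rV[R]_n.+1 :=
  \row_k if unlift i k is Some j then c 0 k + (g j)%:R * h + u * h
         else z g 0 i + s * C * h.
pose T : finType := {ffun 'I_n -> 'I_m.+1}.
exists T, (box 0 (-1)), (box 1 1); split.
- move=> g k; rewrite !mxE; case: unliftP => [j _|_].
    by rewrite lerD2l ler_wpM2r ?ltW.
  lra.
- move=> x Zx.
  have gP (j : 'I_n) : {k : 'I_m.+1 |
      c 0 (lift i j) + k%:R * h <= x 0 (lift i j)
        <= c 0 (lift i j) + k%:R * h + h}.
    have /andP[cx xc] := Zcube x Zx (lift i j).
    pose t := (x 0 (lift i j) - c 0 (lift i j)) / h.
    have t0 : 0 <= t by rewrite divr_ge0 ?subr_ge0// ltW.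
    have /andP[tl tu] := truncn_itv t0.
    have km : (Num.truncn t < m.+1)%N.
      rewrite truncn_lt_nat// /t ltr_pdivrMr// /h mulrC divfK ?pnatr_eq0//.
      by rewrite ltrBlDl.
    move: tl tu; rewrite ler_pdivlMr// ltr_pdivrMr// -natr1 => tl tu.
    by exists (Ordinal km) => /=; lra.
  pose g := [ffun j => sval (gP j)].
  have colx : column g x by split => // j; rewrite ffunE; case: (gP j).
  have [Zz zcol] : column g (z g) by apply: (@xgetI _ _ _ x).
  exists g => //= k; rewrite !mxE; case: unliftP => [j ->|->].
    by case: colx => _ /(_ j); rewrite mul0r mul1r addr0.
  suff : `|x 0 i - z g 0 i| <= C * h by rewrite ler_norml => /andP[]; lra.
  apply: Zgraph => // [|j]; [exact: ltW|rewrite eq_sym] => /unlift_some[{}j -> _].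
  case: colx => _ /(_ j) /andP[x1 x2]; have /andP[z1 z2] := zcol j.
  by rewrite ler_norml; lra.
- have boxvol g : \prod_(k < n.+1) (box 1 1 g 0 k - box 0 (-1) g 0 k) =
      h ^+ n * (C * h *+ 2).
    rewrite (bigD1_ord i)//= mulrC; congr (_ * _).
      rewrite -[in RHS](card_ord n) -prodr_const; apply: eq_bigr => j _.
      by rewrite !mxE liftK; lra.
    by rewrite !mxE unlift_none; lra.
  under eq_bigr do rewrite boxvol.
  rewrite sumr_const card_ffun !card_ord -[leLHS]mulr_natl natrX mulrA -exprMn.
  have mh : m.+1%:R * h = l by rewrite /h mulrC divfK.
  have /andP[_] := truncn_itv V0; rewrite -/m ltr_pdivrMr// => Vm.
  rewrite mh -(ler_pM2l (ltr0Sn R m)); apply: ltW.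
  suff -> : m.+1%:R * (l ^+ n * (C * h *+ 2)) = C * l ^+ n.+1 *+ 2 by [].
  by rewrite exprS -{2}mh; ring.
Qed.

Lemma mpoly_ring_ind (n : nat) (P : mpoly n R -> Prop) :
  (forall c, P (mpolyC n c)) -> (forall i, P (mpolyX R (mnm1 i))) ->
  (forall p q, P p -> P q -> P (p + q)) ->
  (forall p q, P p -> P q -> P (p * q)) -> forall p, P p.
Proof.
move=> PC PX PD PM; elim/mpolyind => [|c m p _ _ Pp]; first by rewrite -mpolyC0.
apply: (PD) => //; rewrite -mul_mpolyC; apply: (PM) => //.
rewrite mpolyXE_id; elim/big_ind: _ => [||i _]; [by rewrite -mpolyC1|exact: PM|].
by elim: (m i) => [|k IH]; rewrite ?expr0 -?mpolyC1// exprS; apply: PM.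
Qed.

(** The bound and the Lipschitz constant are proved together because the Lipschitz estimate of a
    product uses bounds of both factors. *)
Lemma meval_lipschitz (n : nat) (q : mpoly n R) (B : R) :
  exists2 M, 0 <= M & forall x y : 'I_n -> R,
    (forall j, `|x j| <= B) -> (forall j, `|y j| <= B) ->
    `|meval x q| <= M /\ forall d, 0 <= d -> (forall j, `|x j - y j| <= d) ->
      `|meval x q - meval y q| <= M * d.
Proof.
elim/mpoly_ring_ind: q => [c|i|p q [M M0 pM] [L L0 qL]|p q [M M0 pM] [L L0 qL]].
- exists `|c| => // x y _ _; rewrite !mevalC; split=> // d d0 _.
  by rewrite subrr normr0 mulr_ge0.
- exists (Num.max `|B| 1) => [|x y xB yB]; first by rewrite le_max ler01 orbT.
  rewrite !mevalXU; split=> [|d d0 xyd].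
    by rewrite le_max (le_trans (xB i)) ?ler_norm.
  by apply: (le_trans (xyd i)); rewrite ler_peMl// le_max lexx orbT.
- exists (M + L) => [|x y xB yB]; first exact: addr_ge0.
  have [px pxy] := pM _ _ xB yB; have [qx qxy] := qL _ _ xB yB.
  rewrite !mevalD; split=> [|d d0 xyd].
    by apply: le_trans (ler_normD _ _) _; exact: lerD.
  rewrite opprD addrACA mulrDl; apply: le_trans (ler_normD _ _) _.
  by apply: lerD; [exact: pxy|exact: qxy].
- exists (M * L *+ 2) => [|x y xB yB]; first by rewrite mulrn_wge0// mulr_ge0.
  have [px pxy] := pM _ _ xB yB; have [qx qxy] := qL _ _ xB yB.
  have [py _] := pM _ _ yB xB; have ML0 := mulr_ge0 M0 L0.
  rewrite !mevalM normrM; split=> [|d d0 xyd].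
    by rewrite mulr2n -[leLHS]addr0 lerD// ler_pM.
  have -> : meval x p * meval x q - meval y p * meval y q =
    (meval x p - meval y p) * meval x q + meval y p * (meval x q - meval y q).
    by ring.
  have -> : M * L *+ 2 * d = (M * d) * L + M * (L * d) by ring.
  apply: le_trans (ler_normD _ _) _; rewrite !normrM.
  by apply: lerD; apply: ler_pM => //; [exact: pxy|exact: qxy].
Qed.

Definition update (n : nat) (x : 'I_n -> R) i t j := if j == i then t else x j.

(** Along a line parallel to an axis, the partial derivative becomes the derivative of a
    one-variable polynomial, to which the mean value theorem applies. *)
Lemma meval_line (n : nat) (q : mpoly n R) (x : 'I_n -> R) (i : 'I_n) :
  exists u : {poly R}, forall t, u.[t] = meval (update x i t) q /\
    u^`().[t] = meval (update x i t) (mderiv i q).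
Proof.
elim/mpoly_ring_ind: q => [c|j|p q [u pu] [v qv]|p q [u pu] [v qv]].
- by exists c%:P => t; rewrite mderivC meval0 derivC !hornerE mevalC.
- exists (if j == i then 'X else (x j)%:P) => t; rewrite mevalXU /update.
  rewrite mderivX mevalZ mnm1E; case: eqP => [->|_].
    rewrite derivX !hornerE; split=> //.
    have -> : mnm_sub (mnm1 i) (mnm1 i) = mnm0 :> multinom n.
      by apply/mnmP => k; rewrite mnmBE subnn mnm0E.
    by rewrite mpolyX0 meval1.
  by rewrite derivC !hornerE ?mul0r.
- exists (u + v) => t; rewrite derivD mderivD !mevalD !hornerD.
  by have [-> ->] := pu t; have [-> ->] := qv t.
- exists (u * v) => t; rewrite derivM mderivM !(mevalM, mevalD, hornerE).
  by have [-> ->] := pu t; have [-> ->] := qv t.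
Qed.

(* Where a partial derivative does not vanish, the zero set is locally a
   Lipschitz graph over the other coordinates. *)
Lemma null_mpoly_zero_step (n : nat) (q : mpoly n.+1 R) (i : 'I_n.+1) :
  lebesgue_null [set x : 'rV[R]_n.+1 |
    meval (x 0) q = 0 /\ meval (x 0) (mderiv i q) != 0].
Proof.
pose h (k : nat) : R := k.+1%:R^-1.
have h0 k : 0 < h k by rewrite invr_gt0.
pose cell (kg : nat * {ffun 'I_n.+1 -> int}) (x : 'I_n.+1 -> R) :=
  forall j, (kg.2 j)%:~R * h kg.1 <= x j < (kg.2 j)%:~R * h kg.1 + h kg.1.
(* On a steep cell the partial derivative is bounded away from 0. The cells of all mesh sizes
   together are countable, so each can be treated alone. *)
pose steep kg := exists2 c, 0 < c &
  forall x, cell kg x -> c <= `|meval x (mderiv i q)|.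
pose A kg := [set x : 'rV[R]_n.+1 |
  [/\ meval (x 0) q = 0, cell kg (x 0) & steep kg]].
apply: (@sub_null _ _ (\bigcup_kg A kg)).
  move=> x [qx dqx].
  pose B := \sum_j `|x 0 j| + 1.
  have xB j : `|x 0 j| + 1 <= B by rewrite lerD2r (bigD1 j)//= lerDl sumr_ge0.
  have [M M0 dqM] := meval_lipschitz (mderiv i q) B.
  set c := `|meval (x 0) (mderiv i q)|.
  have c0 : 0 < c by rewrite normr_gt0.
  (* Within a cell of side [h k] the partial derivative varies by at most [M * h k], hence by at
     most half its size at [x]: the cell is steep with constant [c / 2]. *)
  pose k := Num.truncn (M *+ 2 / c).
  have Mk : M * h k <= c / 2.
    have : 0 <= M *+ 2 / c by rewrite divr_ge0 ?mulrn_wge0// ltW.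
    move/truncn_itv => /andP[_]; rewrite -/k ltr_pdivrMr// => /ltW.
    rewrite /h ler_pdivrMr// => H; lra.
  pose g : {ffun 'I_n.+1 -> int} := [ffun j => Num.floor (x 0 j * k.+1%:R)].
  have xg j : (g j)%:~R * h k <= x 0 j < (g j)%:~R * h k + h k.
    have /andP[] := real_floor_itv (num_real (x 0 j * k.+1%:R)).
    by rewrite ffunE intrD -{3}[h k]mul1r -mulrDl ler_pdivrMr// ltr_pdivlMr// => -> ->.
  exists (k, g); first by [].
  split=> //; exists (c / 2); first by rewrite divr_gt0.
  move=> y yg; have xy j : `|x 0 j - y j| <= h k.
    have /andP[y1 y2] := yg j; have /andP[x1 x2] := xg j.
    by rewrite ler_norml; move: y1 y2 => /=; lra.
  have hk1 : h k <= 1 by rewrite invf_le1// ler1n.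
  have yB j : `|y j| <= B.
    apply: le_trans (xB j); rewrite addrC -lerBlDr.
    apply: le_trans hk1; apply: le_trans (xy j).
    by rewrite distrC; exact: lerB_dist.
  have xB' j : `|x 0 j| <= B by apply: le_trans (xB j); rewrite lerDl.
  have [_ /(_ _ (ltW (h0 k)) xy) dxy] := dqM (x 0) y xB' yB.
  have := lerB_dist (meval (x 0) (mderiv i q)) (meval y (mderiv i q)).
  by rewrite -/c; lra.
apply: null_bigcup_countable => kg.
have [[c c0 cP]|nst] := pselect (steep kg); last first.
  apply: null_finite_cover => e e0.
  exists 'I_0, (fun=> 0), (fun=> 0); split => //; rewrite ?big_ord0 ?ltW//.
  by move=> x [].
pose B := \sum_j `|(kg.2 j)%:~R * h kg.1| + h kg.1.
have [M M0 qM] := meval_lipschitz q B.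
have cellB x : cell kg x -> forall j, `|x j| <= B.
  move=> cx j; have := cx j.
  have : `|(kg.2 j)%:~R * h kg.1| + h kg.1 <= B.
    by rewrite lerD2r (bigD1 j)//= lerDl sumr_ge0.
  set a := _ * _; move=> aB /andP[ax xa]; apply: le_trans aB.
  have -> : x j = a + (x j - a) by ring.
  apply: le_trans (ler_normD _ _) _; rewrite lerD2l ger0_norm; lra.
apply: (@null_graph _ i _ (\row_j ((kg.2 j)%:~R * h kg.1)) (h kg.1) (M / c)) => //.
- by rewrite divr_ge0// ltW.
- by move=> x [_ cx _] j; rewrite mxE.
move=> x y d [qx cx _] [qy cy _] d0 xyd.
have [-> |xy] := eqVneq (x 0 i) (y 0 i).
  by rewrite subrr normr0 mulr_ge0// divr_ge0// ltW.
have cu t : y 0 i <= t <= x 0 i \/ x 0 i <= t <= y 0 i ->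
    cell kg (update (y 0) i t).
  move=> tP j; rewrite /update; case: eqP => [->|_]; last exact: cy.
  by move: (cx i) (cy i) => /andP[? ?] /andP[? ?]; apply/andP; split; lra.
have [u uP] := meval_line q (y 0) i.
have uy : u.[y 0 i] = 0.
  rewrite (uP _).1 -qy; apply: meval_eq => j; rewrite /update.
  by case: eqP => // ->.
have ux : `|u.[x 0 i]| <= M * d.
  rewrite (uP _).1 -[X in `|X|]subr0 -qx.
  have [||_] := qM (update (y 0) i (x 0 i)) (x 0).
  - by apply: cellB; apply: cu; lra.
  - exact: cellB.
  - apply=> // j; rewrite /update; case: eqP => [->|/eqP ji].
      by rewrite subrr normr0.
    by rewrite distrC xyd.
(* Mean value theorem between [y 0 i], where [u] vanishes, and [x 0 i]. As [u] is at most [M * d] at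
   [x 0 i] and its slope at least [c], the graph has Lipschitz constant [M / c]. *)
have [t [tP tE]] : exists t, (y 0 i <= t <= x 0 i \/ x 0 i <= t <= y 0 i) /\
    `|u.[x 0 i]| = `|u^`().[t]| * `|x 0 i - y 0 i|.
  have [xy'|yx|] := ltgtP (x 0 i) (y 0 i); last by move/eqP; rewrite (negbTE xy).
    have [t /[1!in_itv]/= tP E] := poly_mvt u xy'; exists t; split; first lra.
    by move: E; rewrite uy sub0r => /(congr1 Num.norm); rewrite normrN normrM distrC.
  have [t /[1!in_itv]/= tP E] := poly_mvt u yx; exists t; split; first lra.
  by move: E; rewrite uy subr0 => /(congr1 Num.norm); rewrite normrM.
rewrite mulrAC ler_pdivlMr//; apply: le_trans ux; rewrite tE mulrC.
by rewrite ler_wpM2r// (uP t).2; apply/cP/cu.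
Qed.

(** Induction on the size: a nonconstant [q] has a nonzero partial derivative of smaller size. Its
    zero set is null by induction, and off that set [null_mpoly_zero_step] applies. *)
Lemma null_mpoly_zero (n : nat) (q : mpoly n R) : (0 < n)%N -> q != 0 ->
  lebesgue_null [set x : 'rV[R]_n | meval (x 0) q = 0].
Proof.
case: n q => // n q _; have [k] := ubnP (msize q).
elim: k q => // k IHk q; rewrite ltnS => qk q0.
have [q1|] := leqP (msize q) 1.
  have /msize_poly1P[c c0 ->] : msize q == 1%N.
    by rewrite eqn_leq q1 lt0n msize_poly_eq0.
  apply: null_finite_cover => e e0.
  exists 'I_0, (fun=> 0), (fun=> 0); split => //; rewrite ?big_ord0 ?ltW//.
  by move=> x /=; rewrite mevalC => /eqP; rewrite (negbTE c0).
rewrite msizeE => q1.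
have [m [i [mq mi]]] : exists m (i : 'I_n.+1), m \in msupp q /\ (0 < m i)%N.
  have [m mq m1] : exists2 m, m \in msupp q & (0 < mdeg m)%N.
    apply: contrapT => nm; move: q1; rewrite ltnNge => /negP; apply.
    apply/bigmax_leqP_seq => m mq _; rewrite ltnS leqNgt; apply/negP => m0.
    by apply: nm; exists m.
  exists m; apply: contrapT => nm; move: m1; rewrite mdegE big1// => i _.
  by apply/eqP; rewrite eqn0Ngt; apply/negP => mi; apply: nm; exists i.
(* A monomial containing the i-th variable survives differentiation: its coefficient is multiplied
   by a positive integer. *)
have dq0 : mderiv i q != 0.
  apply/eqP => /(congr1 (mcoeff (mnm_sub m (mnm1 i)))); rewrite mcoeff_deriv mcoeff0.
  rewrite submK; last by apply/mnm_lepP => j; rewrite mnm1E; case: eqP => [<-|].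
  by apply/eqP; rewrite mulrn_eq0 /= -mcoeff_msupp mq.
have dqk : (msize (mderiv i q) < k)%N.
  rewrite msizeE; case: k qk {IHk} => [|k qk].
    by rewrite leqn0 msize_poly_eq0 (negbTE q0).
  rewrite ltnS; apply/bigmax_leqP_seq => m'.
  rewrite mcoeff_msupp mcoeff_deriv => m'q _; rewrite -ltnS.
  apply: leq_trans qk; rewrite -[X in (_ < X)%N]/(msize q).
  have /msize_mdeg_lt : mnm_add m' (mnm1 i) \in msupp q.
    by rewrite mcoeff_msupp; apply: contraNneq m'q => ->; rewrite mul0rn.
  by rewrite mdegD mdeg1 addn1.
have nullU := lebesgue_nullU (ltn0Sn n) (IHk _ dqk dq0) (null_mpoly_zero_step q i).
apply: sub_null nullU => x /= qx.
by have [?|?] := eqVneq (meval (x 0) (mderiv i q)) 0; [left|right].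
Qed.

End Null.

(** * Equations of a network *)

(** The exponent of X that the first of two strain polynomials keeps once a factor X common to both
    is cancelled; the booleans tell which of them vanish at 0. *)
Definition zero_excess (a b : bool) : nat := a && ~~ b.

Definition flip (T : Type) (p : T * T) : T * T := (p.2, p.1).

(* A series connection (b = true) acts through node on the pairs (A, B), a
   parallel one on the pairs (B, A). *)
Definition orient (T : Type) (b : bool) (p : T * T) : T * T :=
  if b then p else flip p.

Lemma orientK (T : Type) b : involutive (@orient T b).
Proof. by case: b => -[]. Qed.

Definition node (T : nzRingType) (al be : nat) (p q : {poly T} * {poly T}) :
    {poly T} * {poly T} :=
  (p.1 * q.1, 'X^al * (p.1 * q.2) + 'X^be * (p.2 * q.1)).

Definition deg_node (al be : nat) (d e : nat * nat) : nat * nat :=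
  (d.1 + e.1, maxn (al + (d.1 + e.2)) (be + (d.2 + e.1)))%N.

Section Trees.
Variables N K : nat.
Implicit Type M : tree N K.

Definition conn (b : bool) M1 M2 : tree N K :=
  if b then Series M1 M2 else Parallel M1 M2.

Lemma conn_ind (P : tree N K -> Prop) :
  (forall j, P (Spring K j)) -> (forall k, P (Dashpot N k)) ->
  (forall b M1 M2, P M1 -> P M2 -> P (conn b M1 M2)) -> forall M, P M.
Proof.
move=> PS PD PC; elim=> [j|k|M1 P1 M2 P2|M1 P1 M2 P2]; [exact: PS|exact: PD| |].
- exact: (PC false).
- exact: (PC true).
Qed.

(** The order of vanishing at 0 of the strain polynomial, the exponent a of the overview. *)
Fixpoint zero_root M : bool :=
  match M with
  | Spring _ => false
  | Dashpot _ => true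
  | Parallel M1 M2 => zero_root M1 && zero_root M2
  | Series M1 M2 => zero_root M1 || zero_root M2
  end.

(** The exponent of X on the product of the first component of [M1] with the second of [M2]. After
    orientation the strain polynomial in that product is that of [M1] in a series connection, that
    of [M2] in a parallel one. *)
Definition node_shift (b : bool) M1 M2 : nat :=
  if b then zero_excess (zero_root M1) (zero_root M2)
  else zero_excess (zero_root M2) (zero_root M1).

(* The pair (A, B) of the equation X^(zero_root M) A epsilon = B sigma, free of
   divisions: the common factor X of two strain polynomials vanishing at 0 is
   the only gcd to be removed for generic parameters. *)
Fixpoint gen (T : nzRingType) (v : 'I_N + 'I_K -> T) M : {poly T} * {poly T} :=
  match M with
  | Spring j => ((v (inl j))%:P, 1)
  | Dashpot k => ((v (inr k))%:P, 1)
  | Parallel M1 M2 =>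
      flip (node (node_shift false M1 M2) (node_shift false M2 M1)
                 (flip (gen v M1)) (flip (gen v M2)))
  | Series M1 M2 => node (node_shift true M1 M2) (node_shift true M2 M1) (gen v M1) (gen v M2)
  end.

Lemma gen_conn (T : nzRingType) (v : 'I_N + 'I_K -> T) b M1 M2 :
  gen v (conn b M1 M2) = orient b (node (node_shift b M1 M2) (node_shift b M2 M1)
    (orient b (gen v M1)) (orient b (gen v M2))).
Proof. by case: b. Qed.

Fixpoint deg M : nat * nat :=
  match M with
  | Spring _ | Dashpot _ => (0, 0)%N
  | Parallel M1 M2 =>
      flip (deg_node (node_shift false M1 M2) (node_shift false M2 M1)
                     (flip (deg M1)) (flip (deg M2)))
  | Series M1 M2 => deg_node (node_shift true M1 M2) (node_shift true M2 M1) (deg M1) (deg M2)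
  end.

Lemma deg_conn b M1 M2 :
  deg (conn b M1 M2) = orient b (deg_node (node_shift b M1 M2) (node_shift b M2 M1)
    (orient b (deg M1)) (orient b (deg M2))).
Proof. by case: b. Qed.

Lemma params_conn b M1 M2 : params (conn b M1 M2) = params M1 ++ params M2.
Proof. by case: b. Qed.

Lemma is_network_conn b M1 M2 : is_network (conn b M1 M2) =
  [&& is_network M1, is_network M2 & ~~ has (mem (params M1)) (params M2)].
Proof. by case: b. Qed.

(** The invariant behind [sh_lt]: with its factor X restored, the strain operator has the order of
    the stress operator or one more. *)
Lemma deg_zero_root M :
  ((deg M).2 <= (deg M).1 + zero_root M <= (deg M).2.+1)%N.
Proof.
elim: M => //= M1 + M2; rewrite /deg_node /node_shift /zero_excess /=;
  case: (zero_root M1) (zero_root M2) => -[] /=; lia.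
Qed.

Lemma sh_lt b M1 M2 :
  (node_shift b M1 M2 + (orient b (deg M1)).1 <= (orient b (deg M1)).2.+1)%N.
Proof.
have := deg_zero_root M1; case: b; rewrite /node_shift /zero_excess /=;
  case: (zero_root M1) (zero_root M2) => -[] /=; lia.
Qed.

Lemma sh_cases b M1 M2 :
  [\/ node_shift b M1 M2 = 0 /\ node_shift b M2 M1 = 0, node_shift b M1 M2 = 1 /\ node_shift b M2 M1 = 0
    | node_shift b M1 M2 = 0 /\ node_shift b M2 M1 = 1]%N.
Proof.
rewrite /node_shift /zero_excess; case: b; case: (zero_root M1) (zero_root M2) => -[] /=;
  by [exact: Or31|exact: Or32|exact: Or33].
Qed.

Definition num_coef M := ((deg M).1 + (deg M).2).+1.

(** By [sh_lt], the strict inequalities are the equalities al + d.1 = d.2 + 1 and be + e.1 = e.2 + 1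
    of the overview. *)
Definition good_node b M1 M2 : bool :=
  let d := orient b (deg M1) in let e := orient b (deg M2) in
  (d.2 < node_shift b M1 M2 + d.1)%N || (e.2 < node_shift b M2 M1 + e.1)%N.

(** In the notation of [good_node], the count of the connection is the sum of the two counts plus
    max (al + d.1 - d.2, be + e.1 - e.2) - 1, and both entries are at most 1 by [sh_lt]. *)
Lemma num_coef_conn b M1 M2 :
  (num_coef (conn b M1 M2) <= num_coef M1 + num_coef M2)%N /\
  (num_coef (conn b M1 M2) == num_coef M1 + num_coef M2)%N = good_node b M1 M2.
Proof.
rewrite /num_coef deg_conn /good_node.
have := sh_lt b M1 M2; have := sh_lt b M2 M1.
move: (node_shift b M1 M2) (node_shift b M2 M1) (deg M1) (deg M2) => al be [k1 l1] [k2 l2].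
case: b => /=; lia.
Qed.

Lemma num_coef_le M : (num_coef M <= size (params M))%N.
Proof.
elim/conn_ind: M => // b M1 M2 le1 le2; rewrite params_conn size_cat.
by apply: leq_trans (num_coef_conn b M1 M2).1 _; exact: leq_add.
Qed.

(** Both counts are bounded by numbers of parameters, so equality for the whole forces equality in
    each part and additivity at the connection. *)
Lemma num_coef_conn_eq b M1 M2 :
  (num_coef (conn b M1 M2) == size (params (conn b M1 M2))) =
  [&& num_coef M1 == size (params M1), num_coef M2 == size (params M2) & good_node b M1 M2].
Proof.
rewrite params_conn size_cat; have [le12 <-] := num_coef_conn b M1 M2.
have := num_coef_le M1; have := num_coef_le M2; lia.
Qed.

Lemma eq_gen (T : nzRingType) (v w : 'I_N + 'I_K -> T) M :
  {in params M, v =1 w} -> gen v M = gen w M.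
Proof.
elim/conn_ind: M => [j|k|b M1 M2 IH1 IH2 vw] /=.
- by move=> -> //; rewrite inE.
- by move=> -> //; rewrite inE.
by rewrite !gen_conn IH1 ?IH2// => p pM; apply: vw;
  rewrite params_conn mem_cat pM ?orbT.
Qed.

End Trees.

Definition map_pair (T S : nzRingType) (f : T -> S) (p : {poly T} * {poly T}) :=
  (map_poly f p.1, map_poly f p.2).

(** As [gen] contains no division, it commutes with evaluation of the parameters and with passage to
    fractions; this ties the symbolic equation to its values. *)
Lemma map_gen N K (T S : nzRingType) (f : {rmorphism T -> S})
    (v : 'I_N + 'I_K -> T) (M : tree N K) :
  gen (f \o v) M = map_pair f (gen v M).
Proof.
elim/conn_ind: M => [j|k|b M1 M2 IH1 IH2]; rewrite /map_pair /=.
- by rewrite map_polyC rmorph1.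
- by rewrite map_polyC rmorph1.
rewrite !gen_conn IH1 IH2; case: b; rewrite /= /map_pair /node /flip /=;
  by rewrite !(rmorphM, rmorphD) /= !map_polyXn.
Qed.

(** * Positivity of all coefficients at positive parameters *)

Section Full.
Variable R : realFieldType.
Implicit Types p q : {poly R}.

Definition full (n : nat) p :=
  (forall i, (i <= n)%N -> 0 < p`_i) /\ (forall i, (n < i)%N -> p`_i = 0).

Lemma full_ge0 n p i : full n p -> 0 <= p`_i.
Proof. by move=> [p0 p1]; have [/p0/ltW|/p1->] := leqP i n. Qed.

Lemma full_size n p : full n p -> size p = n.+1.
Proof.
move=> [p0 p1]; apply/eqP; rewrite eqn_leq; apply/andP; split.
  by apply/leq_sizeP => i /p1.
by rewrite ltnNge; apply/negP => /leq_sizeP/(_ n (leqnn n))/eqP; rewrite gt_eqF// p0.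
Qed.

Lemma full_neq0 n p : full n p -> p != 0.
Proof. by move=> /full_size np; rewrite -size_poly_eq0 np. Qed.

Lemma full_mul n m p q : full n p -> full m q -> full (n + m) (p * q).
Proof.
move=> fp fq; split=> i im; rewrite coefM.
  have j0 : (minn i n < i.+1)%N by lia.
  rewrite (bigD1 (Ordinal j0))//= ltr_pwDl// ?mulr_gt0 ?fp.1 ?fq.1//; try lia.
  by apply: sumr_ge0 => j _; rewrite mulr_ge0 ?(full_ge0 _ fp) ?(full_ge0 _ fq).
apply: big1 => j _; have [jn|jn] := leqP j n; last by rewrite fp.2 ?mul0r.
by rewrite fq.2 ?mulr0//; lia.
Qed.

(** At least one summand is unshifted and the other is shifted by at most 1, so the two ranges of
    positive coefficients leave no gap. *)
Lemma full_shift_add al be n m p q : (al + be <= 1)%N ->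
  full n p -> full m q -> full (maxn (al + n) (be + m)) ('X^al * p + 'X^be * q).
Proof.
move=> ab fp fq; split=> i im; rewrite coefD !coefXnM.
  have [ia|ia] := ltnP i al; have [ib|ib] := ltnP i be; try lia.
  - by rewrite add0r fq.1; lia.
  - by rewrite addr0 fp.1; lia.
  have [jn|jn] := leqP (i - al) n.
    by rewrite ltr_pwDl// ?fp.1// (full_ge0 _ fq).
  by rewrite ltr_wpDl ?(full_ge0 _ fp)// fq.1; lia.
by rewrite !ifF ?fp.2 ?fq.2 ?addr0//; lia.
Qed.

Definition full_pair (d : nat * nat) (p : {poly R} * {poly R}) :=
  full d.1 p.1 /\ full d.2 p.2.

Lemma full_orient b d (p : {poly R} * {poly R}) :
  full_pair (orient b d) (orient b p) <-> full_pair d p.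
Proof. by case: b; split=> -[]. Qed.

Lemma full_node al be d e (p q : {poly R} * {poly R}) : (al + be <= 1)%N ->
  full_pair d p -> full_pair e q ->
  full_pair (deg_node al be d e) (node al be p q).
Proof.
move=> ab [p1 p2] [q1 q2]; split; first exact: full_mul.
by apply: full_shift_add => //; exact: full_mul.
Qed.

Lemma sh_le1 N K b (M1 M2 : tree N K) : (node_shift b M1 M2 + node_shift b M2 M1 <= 1)%N.
Proof. by have [] := sh_cases b M1 M2 => -[-> ->]. Qed.

Lemma full_gen N K (v : 'I_N + 'I_K -> R) (M : tree N K) :
  (forall i, 0 < v i) -> full_pair (deg M) (gen v M).
Proof.
move=> v0; have fullC (c : R) : 0 < c -> full 0 c%:P.
  by move=> c0; split=> -[|i] // _; rewrite coefC.
elim/conn_ind: M => [j|k|b M1 M2 IH1 IH2].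
- by split=> /=; [exact: fullC|rewrite -polyC1; exact: fullC].
- by split=> /=; [exact: fullC|rewrite -polyC1; exact: fullC].
rewrite deg_conn gen_conn; apply/full_orient/full_node; first exact: sh_le1.
  exact/full_orient.
exact/full_orient.
Qed.

Lemma coprimep_Xn n k p : full n p -> coprimep 'X^k p.
Proof.
move=> fp; apply: coprimep_expl; rewrite coprimep_sym.
have := coprimep_XsubC p 0; rewrite subr0 => ->; rewrite /root horner_coef0.
by rewrite gt_eqF// fp.1.
Qed.

(** Modulo [p.1] the second component is X^be p.2 q.1, modulo [q.1] it is X^al p.1 q.2. The powers
    of X do not matter, since [p.1] and [q.1] have positive constant coefficients. *)
Lemma coprime_node d e al be (p q : {poly R} * {poly R}) :
    full_pair d p -> full_pair e q ->
  coprimep (node al be p q).1 (node al be p q).2 =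
  [&& coprimep p.1 q.1, coprimep p.1 p.2 & coprimep q.1 q.2].
Proof.
move=> [fp _] [fq _]; rewrite /node /= coprimepMl.
have pX k : coprimep p.1 'X^k by rewrite coprimep_sym (coprimep_Xn _ fp).
have qX k : coprimep q.1 'X^k by rewrite coprimep_sym (coprimep_Xn _ fq).
rewrite mulrCA [p.1 * _]mulrC coprimep_addl_mul mulrA addrC coprimep_addl_mul.
rewrite !coprimepMr pX qX /= [coprimep q.1 p.1]coprimep_sym.
by case: (coprimep p.1 q.1); rewrite ?andbF ?andbT.
Qed.
End Full.

(** * Generic parameters *)

(** If the leading coefficients survive, the sizes do too, and the Sylvester matrix is mapped entry
    by entry. *)
Lemma rmorph_resultant (T S : nzRingType) (f : {rmorphism T -> S})
    (p q : {poly T}) : f (lead_coef p) != 0 -> f (lead_coef q) != 0 ->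
  f (resultant p q) = resultant (map_poly f p) (map_poly f q).
Proof.
(* The sizes become arguments of [Syl], so that they can be rewritten in spite of the matrix type
   depending on them. *)
move=> p0 q0; pose Syl m n (a b : {poly S}) : 'M[S]_(m + n) :=
  col_mx (lin1_mx (poly_rV \o *%R^~ a \o rVpoly))
         (lin1_mx (poly_rV \o *%R^~ b \o rVpoly)).
rewrite [RHS]/resultant -[Sylvester_mx _ _]/(Syl _ _ _ _).
rewrite !size_map_poly_id0// -det_map_mx; congr (\det _).
rewrite /Sylvester_mx map_col_mx; congr (col_mx _ _); apply/matrixP => i j;
  by rewrite !mxE /= !rVpoly_delta !coefXnM; case: ifP; rewrite ?rmorph0 ?coef_map.
Qed.

Lemma size_mul_le (T : nzRingType) (p q : {poly T}) m n :
  (size p <= m.+1)%N -> (size q <= n.+1)%N -> (size (p * q)%R <= (m + n).+1)%N.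
Proof. by move=> pm qn; apply: leq_trans (size_polyMleq _ _) _; lia. Qed.

Lemma size_Xn_mul_le (T : nzRingType) k (p : {poly T}) n :
  (size p <= n.+1)%N -> (size ('X^k * p)%R <= (k + n).+1)%N.
Proof. by move=> pn; apply: size_mul_le => //; rewrite size_polyXn. Qed.

Lemma size_add_le (T : nzRingType) (p q : {poly T}) n :
  (size p <= n)%N -> (size q <= n)%N -> (size (p + q)%R <= n)%N.
Proof. by move=> pn qn; rewrite (leq_trans (size_polyD _ _))// geq_max pn. Qed.

Section Generic.
Variables N K : nat.
Implicit Type M : tree N K.

(** At every connection, the two polynomials whose gcd is divided out are coprime apart from the
    powers of X that [gen] leaves aside. *)
Fixpoint generic (F : idomainType) (v : 'I_N + 'I_K -> F) M : bool :=
  match M with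
  | Spring _ | Dashpot _ => true
  | Parallel M1 M2 =>
      [&& generic v M1, generic v M2 & coprimep (gen v M1).2 (gen v M2).2]
  | Series M1 M2 =>
      [&& generic v M1, generic v M2 & coprimep (gen v M1).1 (gen v M2).1]
  end.

Lemma generic_conn (F : idomainType) (v : 'I_N + 'I_K -> F) b M1 M2 :
  generic v (conn b M1 M2) = [&& generic v M1, generic v M2
    & coprimep (orient b (gen v M1)).1 (orient b (gen v M2)).1].
Proof. by case: b. Qed.

Lemma eq_generic (F : idomainType) (v w : 'I_N + 'I_K -> F) M :
  {in params M, v =1 w} -> generic v M = generic w M.
Proof.
elim/conn_ind: M => // b M1 M2 IH1 IH2 vw.
have [vw1 vw2] : {in params M1, v =1 w} /\ {in params M2, v =1 w}.
  by split=> p pM; apply: vw; rewrite params_conn mem_cat pM ?orbT.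
by rewrite !generic_conn IH1 ?IH2 ?(eq_gen vw1) ?(eq_gen vw2).
Qed.

Lemma coprime_gen (R : realFieldType) (v : 'I_N + 'I_K -> R) M :
  (forall i, 0 < v i) -> generic v M -> coprimep (gen v M).1 (gen v M).2.
Proof.
move=> v0; elim/conn_ind: M => [j _|k _|b M1 M2 IH1 IH2]; rewrite ?coprimep1//.
rewrite generic_conn gen_conn => /and3P[/IH1 c1 /IH2 c2 c12].
have cop_orient (p : {poly R} * {poly R}) :
    coprimep (orient b p).1 (orient b p).2 = coprimep p.1 p.2.
  by case: b {c12}; rewrite //= coprimep_sym.
rewrite cop_orient (@coprime_node _ (orient b (deg M1)) (orient b (deg M2)));
  try exact/full_orient/full_gen.
by rewrite c12 !cop_orient c1 c2.
Qed.

Lemma size_gen (T : nzRingType) (v : 'I_N + 'I_K -> T) M :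
  (size (gen v M).1 <= (deg M).1.+1)%N /\ (size (gen v M).2 <= (deg M).2.+1)%N.
Proof.
elim/conn_ind: M => [j|k|b M1 M2 IH1 IH2] /=.
- by rewrite size_polyC size_poly1; split=> //; case: eqP.
- by rewrite size_polyC size_poly1; split=> //; case: eqP.
have szD (p q : {poly T}) m n : (size p <= m.+1)%N -> (size q <= n.+1)%N ->
    (size (p + q)%R <= (maxn m n).+1)%N.
  by move=> pm qn; apply: leq_trans (size_polyD _ _) _; lia.
rewrite gen_conn deg_conn; case: b => /=; case: IH1 => ? ?; case: IH2 => ? ?.
- by split; [|apply: szD; apply: size_Xn_mul_le]; exact: size_mul_le.
- by split; [apply: szD; apply: size_Xn_mul_le|]; exact: size_mul_le.
Qed.

(** The product of resultants of the overview: one polynomial in the parameters that detects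
    [generic] ([disc_meval]). *)
Fixpoint disc (T : comNzRingType) (v : 'I_N + 'I_K -> T) M : T :=
  match M with
  | Spring _ | Dashpot _ => 1
  | Parallel M1 M2 => disc v M1 * disc v M2 * resultant (gen v M1).2 (gen v M2).2
  | Series M1 M2 => disc v M1 * disc v M2 * resultant (gen v M1).1 (gen v M2).1
  end.

Lemma disc_neq0 (F : idomainType) (v : 'I_N + 'I_K -> F) M :
  (forall M', (gen v M').1 != 0 /\ (gen v M').2 != 0) ->
  (disc v M != 0) = generic v M.
Proof.
move=> v0; have res0 (p q : {poly F}) : p != 0 -> q != 0 ->
    (resultant p q != 0) = coprimep p q.
  move=> p0 q0; rewrite resultant_eq0 coprimep_def -leqNgt eqn_leq andb_idr//.
  by move=> _; rewrite lt0n size_poly_eq0 gcdp_eq0 negb_and p0.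
elim: M => [j|k|M1 IH1 M2 IH2|M1 IH1 M2 IH2] /=; rewrite ?oner_neq0//;
  rewrite !mulf_eq0 !negb_or IH1 IH2 res0 ?andbA//; by case: (v0 M1); case: (v0 M2).
Qed.

Lemma rmorph_disc (T S : comNzRingType) (f : {rmorphism T -> S})
    (v : 'I_N + 'I_K -> T) M :
  (forall M', f (lead_coef (gen v M').1) != 0 /\ f (lead_coef (gen v M').2) != 0) ->
  f (disc v M) = disc (f \o v) M.
Proof.
move=> v0; elim: M => [j|k|M1 IH1 M2 IH2|M1 IH1 M2 IH2] /=; rewrite ?rmorph1//;
  rewrite !rmorphM IH1 IH2 rmorph_resultant ?map_gen//;
  by case: (v0 M1); case: (v0 M2).
Qed.
End Generic.

(** * Existence of generic positive parameters *)

Section Scaling.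
Variable R : realType.
Implicit Types p q : {poly R}.

(** A common complex root z of p and q(tX) is nonzero because p(0) is, and t z is a root w of q. So
    t lies in the finite set of ratios w / z, which some positive integer avoids. *)
Lemma coprime_scaled p q : p.[0] != 0 -> q != 0 ->
  exists2 t : R, 0 < t & coprimep p (q \Po (t *: 'X)).
Proof.
move=> p0 q0; pose f : {rmorphism R -> R[i]%C} := real_complex R.
have [rp pE] := closed_field_poly_normal (map_poly f p).
have [rq qE] := closed_field_poly_normal (map_poly f q).
have p0' : p != 0 by apply: contraNneq p0 => ->; rewrite horner0.
have rootE r (g : {poly R}) : g != 0 ->
    map_poly f g = lead_coef (map_poly f g) *: \prod_(z <- r) ('X - z%:P) ->
    forall z, root (map_poly f g) z = (z \in r).
  move=> g0 gE z; rewrite gE rootZ ?root_prod_XsubC//.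
  by rewrite lead_coef_eq0 map_poly_eq0.
pose L := [seq w / z | w <- rq, z <- rp].
have [n n0 nL] : exists2 n, (0 < n)%N & f n%:R \notin L.
  apply: contrapT => H.
  have sub : {subset [seq f n%:R | n <- iota 1 (size L).+1] <= L}.
    move=> _ /mapP[n + ->]; rewrite mem_iota => /andP[n0 _].
    by apply: contrapT => /negP nL; apply: H; exists n.
  have un : uniq [seq f n%:R | n <- iota 1 (size L).+1].
    rewrite map_inj_uniq ?iota_uniq// => m n /fmorph_inj/eqP.
    by rewrite eqr_nat => /eqP.
  by have := uniq_leq_size un sub; rewrite size_map size_iota ltnn.
exists n%:R; first by rewrite ltr0n.
rewrite -(coprimep_map f); apply: Pdiv.ClosedField.root_coprimep => z zp.
have z0 : z != 0.
  apply: contraTneq zp => ->; rewrite -(rmorph0 f) /root horner_map fmorph_eq0.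
  by [].
rewrite map_comp_poly horner_comp map_polyZ map_polyX hornerZ hornerX.
apply: contraNneq nL => nz; rewrite -[f _](mulfK z0); apply: allpairs_f.
  by rewrite -(rootE _ _ q0 qE) /root; apply/eqP.
by rewrite -(rootE _ _ p0' pE).
Qed.

Variables N K : nat.
Implicit Type M : tree N K.

(* A change of time unit, which substitutes t X for X in the equation: it
   separates the nonzero roots of the polynomials of two subnetworks. *)
Definition scale_eta (t : R) (v : 'I_N + 'I_K -> R) i :=
  match i with inl _ => v i | inr _ => t * v i end.

(** Scaling each viscosity replaces X by tX in the element equations, hence throughout. The factor
    X^a left out of the pair turns into t^a X^a, which accounts for the power of t on the first
    component. *)
Lemma gen_scale_eta t v M : t != 0 -> exists2 l, l != 0 &
  gen (scale_eta t v) M = ((l * t ^+ zero_root M) *: ((gen v M).1 \Po (t *: 'X)),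
                           l *: ((gen v M).2 \Po (t *: 'X))).
Proof.
move=> t0.
elim: M => [j|k|M1 [l1 l10 E1] M2 [l2 l20 E2]|M1 [l1 l10 E1] M2 [l2 l20 E2]] /=.
- exists 1; rewrite ?oner_neq0// !comp_polyC mul1r expr0 !scale1r.
  by rewrite rmorph1.
- exists 1; rewrite ?oner_neq0// !comp_polyC mul1r expr1 !scale1r.
  by rewrite rmorph1 -mul_polyC -polyCM.
- exists (l1 * l2); first by rewrite mulf_neq0.
  rewrite E1 E2 /node /flip /node_shift /zero_excess /=.
  case: (zero_root M1) (zero_root M2) => -[] /=; rewrite ?expr0 ?expr1;
   congr (_, _); rewrite !(comp_polyM, comp_polyD) ?rmorph1 ?comp_polyX
    -!mul_polyC !polyCM; ring.
(* If both strain polynomials vanish at 0, each scaled first component brings one [t], and only one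
   of them is absorbed by the power [zero_root] of the series connection. *)
- exists (l1 * l2 * t ^+ (zero_root M1 && zero_root M2)).
    by rewrite !mulf_neq0// expf_neq0.
  rewrite E1 E2 /node /flip /node_shift /zero_excess /=.
  case: (zero_root M1) (zero_root M2) => -[] /=; rewrite ?expr0 ?expr1;
   congr (_, _); rewrite !(comp_polyM, comp_polyD) ?rmorph1 ?comp_polyX
    -!mul_polyC !polyCM; ring.
Qed.

Lemma generic_scale_eta t v M : t != 0 ->
  generic v M -> generic (scale_eta t v) M.
Proof.
move=> t0; elim/conn_ind: M => // b M1 M2 IH1 IH2.
rewrite !generic_conn => /and3P[/IH1 -> /IH2 -> /=].
have [l1 l10 ->] := gen_scale_eta v M1 t0; have [l2 l20 ->] := gen_scale_eta v M2 t0.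
by move/(coprimep_comp_poly (t *: 'X)); case: b => /= c12;
  rewrite coprimepZl ?coprimepZr// ?mulf_neq0 ?expf_neq0.
Qed.

(** Generic values of the two parts are combined, the parameters being disjoint. Rescaling time in
    [M2] keeps it generic and separates its roots from those of [M1]. *)
Lemma exists_generic M : is_network M ->
  exists2 v : 'I_N + 'I_K -> R, (forall i, 0 < v i) & generic v M.
Proof.
elim/conn_ind: M => [j _|k _|b M1 M2 IH1 IH2]; try by exists (fun=> 1).
rewrite is_network_conn => /and3P[/IH1[v1 v10 g1] /IH2[v2 v20 g2] dis].
have := proj1 ((full_orient b _ _).2 (full_gen M1 v10)).
have := proj1 ((full_orient b _ _).2 (full_gen M2 v20)).
set p := (orient b (gen v1 M1)).1; set q := (orient b (gen v2 M2)).1 => fq fp.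
have [|t t0 cop] := coprime_scaled (p := p) _ (full_neq0 fq).
  by rewrite horner_coef0 gt_eqF// fp.1.
have tn0 : t != 0 by rewrite gt_eqF.
pose v i := if i \in params M1 then v1 i else scale_eta t v2 i.
exists v.
  by move=> i; rewrite /v; case: ifP => // _; case: i => [j|k] /=; rewrite ?mulr_gt0.
have vv1 : {in params M1, v =1 v1} by move=> i iM; rewrite /v iM.
have vv2 : {in params M2, v =1 scale_eta t v2}.
  by move=> i iM; rewrite /v ifN//; apply: contra dis => iM1; apply/hasP; exists i.
rewrite generic_conn (eq_generic vv1) (eq_generic vv2) g1 generic_scale_eta//=.
rewrite (eq_gen vv1) (eq_gen vv2).
have [l l0 ->] := gen_scale_eta v2 M2 tn0.
by move: cop; rewrite /p /q; case: (b) => /= cop;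
  rewrite coprimepZr// ?mulf_neq0 ?expf_neq0.
Qed.
End Scaling.

(** * Finite fibers *)

(** If r = e d0 is a proper factorization, a divisor d of r is gcd (d, d0) times a divisor of e, and
    both factors range over finite lists by induction on the size. *)
Lemma finitely_many_divisors (F : fieldType) (r : {poly F}) : r != 0 ->
  exists s : seq {poly F}, forall d, d %| r -> exists2 u, u \in s & d %= u.
Proof.
have [n] := ubnP (size r); elim: n r => // n IHn r; rewrite ltnS => rn r0.
have [[d0 [d0r d01 d0r']]|H] := pselect (exists d,
    [/\ d %| r, ~~ (d %= 1) & ~~ (d %= r)]); last first.
  exists [:: 1; r] => d dr; have [d1|d1] := boolP (d %= 1).
    by exists 1; rewrite ?inE ?eqxx.
  have [dr'|dr'] := boolP (d %= r); first by exists r; rewrite ?inE ?eqxx ?orbT.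
  by case: H; exists d.
have /dvdpP[e rE] := d0r.
have [e0 d00] : e != 0 /\ d0 != 0.
  by apply/andP; rewrite -negb_or -mulf_eq0 -rE.
have sr : size r = (size e + size d0).-1 by rewrite rE size_mul.
have d02 : (1 < size d0)%N.
  by rewrite ltn_neqAle eq_sym size_poly_eq1 d01 lt0n size_poly_eq0.
have e2 : (1 < size e)%N.
  rewrite ltn_neqAle eq_sym lt0n size_poly_eq0 e0 andbT size_poly_eq1.
  apply: contra d0r'; rewrite rE eqp_sym => /(eqp_mull d0).
  by rewrite mulr1 mulrC.
move: rn; rewrite sr => rn.
have [|s sP] := IHn d0 _ d00.
  by apply: leq_trans rn; case: (size e) e2 => [|[|k]]// _; rewrite !addSn ltnS leq_addl.
have [|s' s'P] := IHn e _ e0.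
  by apply: leq_trans rn; case: (size d0) d02 => [|[|k]]// _; rewrite !addnS ltnS leq_addr.
exists [seq a * b | a <- s, b <- s'] => d dr.
have d_neq0 : d != 0 by apply: contraTneq dr => ->; rewrite dvd0p.
pose g := gcdp d d0.
have g0 : g != 0 by rewrite gcdp_eq0 negb_and d_neq0.
have [a aS ga] := sP g (dvdp_gcdr _ _).
have de : d %/ g %| e.
  have cop : coprimep (d %/ g) (d0 %/ g) by apply: coprimep_div_gcd; rewrite d_neq0.
  rewrite -(Gauss_dvdpr _ cop).
  rewrite -(dvdp_mul2r _ _ g0) divpK ?dvdp_gcdl// mulrAC divpK ?dvdp_gcdr//.
  by rewrite mulrC -rE.
have [b bS gb] := s'P _ de.
exists (a * b); first exact: allpairs_f.
have -> : d = g * (d %/ g) by rewrite mulrC divpK ?dvdp_gcdl.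
exact: eqp_trans (eqp_mulr _ ga) (eqp_mull _ gb).
Qed.

Definition scale (T : nzRingType) (c : T) (p : {poly T} * {poly T}) :=
  (c *: p.1, c *: p.2).

Lemma orient_scale (T : nzRingType) b (c : T) p :
  orient b (scale c p) = scale c (orient b p).
Proof. by case: b. Qed.

(** Once the first components agree up to scalars, the deviations W and Y of the second ones satisfy
    X^al p.1 Y = X^be q.1 W up to scalars. By coprimality X^al p.1 divides W and X^be q.1 divides Y;
    additivity makes one divisor too large, so one deviation vanishes and then the other. *)
Lemma node_unique (R : realFieldType) al be d e (p q p' q' : {poly R} * {poly R}) k :
    full_pair d p -> full_pair d p' -> full_pair e q -> full_pair e q' ->
    (al + be <= 1)%N -> (d.2 < al + d.1)%N || (e.2 < be + e.1)%N ->
    coprimep p.1 q.1 -> k != 0 -> node al be p' q' = scale k (node al be p q) ->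
    p'.1 %= p.1 ->
  exists2 c, c.1 != 0 /\ c.2 != 0 & p' = scale c.1 p /\ q' = scale c.2 q.
Proof.
move=> [fp1 fp2] [fp1' fp2'] [fq1 fq2] [fq1' fq2'] ab small cop k0 [E1 E2].
move=> /eqpP[[c c'] /andP[c0 c'0] /= E].
have p10 := full_neq0 fp1; have q10 := full_neq0 fq1.
have {c c' c0 c'0 E} [c c0 pE] : exists2 c, c != 0 & p'.1 = c *: p.1.
  exists (c^-1 * c'); first by rewrite mulf_neq0 ?invr_eq0.
  by rewrite -scalerA -E scalerA mulVf// scale1r.
pose c2 := k / c; have c20 : c2 != 0 by rewrite mulf_neq0 ?invr_eq0.
have kE : k = c * c2 by rewrite mulrC divfK.
have qE : q'.1 = c2 *: q.1.
  apply: (mulfI p10); apply: (scalerI c0).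
  rewrite [LHS]scalerAl -pE E1 -scalerAr scalerA.
  by rewrite -kE.
pose Y := q'.2 - c2 *: q.2; pose W := c *: p.2 - p'.2.
have YW : c *: ('X^al * p.1 * Y) = c2 *: ('X^be * q.1 * W).
  move: E2; rewrite pE qE kE /Y /W -!mul_polyC !polyCM => E2.
  apply/eqP; rewrite -subr_eq0; move/eqP: E2; rewrite -subr_eq0 => /eqP <-.
  by apply/eqP; ring.
have copX : coprimep ('X^al * p.1) ('X^be * q.1).
  rewrite coprimepMl !coprimepMr cop [coprimep p.1 'X^be]coprimep_sym.
  rewrite (coprimep_Xn _ fq1) (coprimep_Xn _ fp1) !andbT.
  by case: al be ab {YW E1 E2 small} => [|[|//]] [|[|//]] // _;
    rewrite ?expr0 ?coprime1p ?coprimep1.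
have PW : 'X^al * p.1 %| W.
  have : 'X^al * p.1 %| c2 *: ('X^be * q.1 * W) by rewrite -YW dvdpZr// dvdp_mulr.
  by rewrite dvdpZr// Gauss_dvdpr.
have QY : 'X^be * q.1 %| Y.
  have : 'X^be * q.1 %| c *: ('X^al * p.1 * Y) by rewrite YW dvdpZr// dvdp_mulr.
  by rewrite dvdpZr// Gauss_dvdpr// coprimep_sym.
have szX n m (u : {poly R}) : full n u -> size ('X^m * u) = (m + n).+1.
  by move=> fu; rewrite mulrC size_mulXn ?(full_neq0 fu)// (full_size fu) addnS.
have P0 : 'X^al * p.1 != 0 by rewrite -size_poly_eq0 (szX _ _ _ fp1).
have Q0 : 'X^be * q.1 != 0 by rewrite -size_poly_eq0 (szX _ _ _ fq1).
(* A multiple of ['X^al * p.1] of size at most [d.2.+1] is 0 when [d.2 < al + d.1]; likewise for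
   [Y]. *)
have {small} WY : W = 0 \/ Y = 0.
  have szB m (u w : {poly R}) a : full m u -> full m w ->
      (size (u - a *: w)%R <= m.+1)%N.
    move=> fu fw; apply: leq_trans (size_polyD _ _) _; rewrite size_polyN geq_max.
    by rewrite (full_size fu) leqnn -(full_size fw) size_scale_leq.
  case/orP: small => [small|small]; [left|right]; apply/eqP; apply: contraTT small.
    move=> /(dvdp_leq)/(_ PW); rewrite (szX _ _ _ fp1) -leqNgt => szW.
    rewrite -ltnS; apply: leq_trans szW _.
    by rewrite /W -opprB size_polyN szB.
  move=> /(dvdp_leq)/(_ QY); rewrite (szX _ _ _ fq1) -leqNgt => szY.
  by rewrite -ltnS; apply: leq_trans szY _; rewrite szB.
have [W0 Y0] : W = 0 /\ Y = 0.
  case: WY => E; rewrite E !mulr0 scaler0 in YW; split=> //; apply/eqP.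
    by move/eqP: YW; rewrite scaler_eq0 (negbTE c0) mulf_eq0 (negbTE P0).
  by move/esym/eqP: YW; rewrite scaler_eq0 (negbTE c20) mulf_eq0 (negbTE Q0).
exists (c, c2) => //; rewrite /scale /= -pE -qE; split.
  by move/eqP: W0; rewrite subr_eq0 => /eqP ->; exact: surjective_pairing.
by move/eqP: Y0; rewrite subr_eq0 => /eqP <-; exact: surjective_pairing.
Qed.

Section Fiber.
Variables (R : realType) (N K : nat).
Implicit Types (M : tree N K) (th : 'rV[R]_(N + K)) (P : seq ('I_N + 'I_K)).

Definition env th (p : 'I_N + 'I_K) : R := th 0 (unsplit p).

Lemma env_gt0 th : param_space th -> forall p, 0 < env th p.
Proof. by move=> th0 p; exact: th0. Qed.

Definition splice P th1 th2 : 'rV[R]_(N + K) :=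
  \row_(i < N + K) if fintype.split i \in P then th1 0 i else th2 0 i.

Lemma env_splice P th1 th2 p :
  env (splice P th1 th2) p = if p \in P then env th1 p else env th2 p.
Proof. by rewrite /env mxE unsplitK. Qed.

Lemma splice_gt0 P th1 th2 :
  param_space th1 -> param_space th2 -> param_space (splice P th1 th2).
Proof. by move=> th10 th20 i; rewrite mxE; case: ifP. Qed.

Definition proportional (p q : {poly R} * {poly R}) :=
  exists2 c, c != 0 & p = scale c q.

Lemma proportional_sym p q : proportional p q -> proportional q p.
Proof.
move=> [c c0 ->]; exists c^-1; rewrite ?invr_eq0//.
by rewrite /scale /= !scalerA mulVf// !scale1r; case: q.
Qed.

Lemma proportional_trans p q r :
  proportional p q -> proportional q r -> proportional p r.
Proof.
move=> [c c0 ->] [d d0 ->]; exists (c * d); first by rewrite mulf_neq0.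
by rewrite /scale /= !scalerA.
Qed.

Lemma proportional_orient b p q :
  proportional (orient b p) (orient b q) <-> proportional p q.
Proof.
split=> -[c c0 E]; exists c => //; last by rewrite E orient_scale.
by rewrite -[p](orientK b) E -orient_scale orientK.
Qed.

Lemma proportional_node al be p p' q q' :
  proportional p p' -> proportional q q' ->
  proportional (node al be p q) (node al be p' q').
Proof.
move=> [c c0 ->] [d d0 ->]; exists (c * d); first by rewrite mulf_neq0.
rewrite /node /scale /= -!mul_polyC !polyCM; congr pair; ring.
Qed.

Definition same_eqn M th : set 'rV[R]_(N + K) := [set th' |
  param_space th' /\ proportional (gen (env th') M) (gen (env th) M)].

(** The equation of a subnetwork leaves foreign parameters free, so finiteness is meaningful only
    for the restrictions to [P]. *)
Definition finite_on P (S : set 'rV[R]_(N + K)) := exists t : seq 'rV[R]_(N + K),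
  forall th, S th -> exists2 w, w \in t & {in P, env th =1 env w}.

Lemma finite_on_cover P S (I : eqType) (s : seq I) (C : I -> set 'rV[R]_(N + K)) :
  (forall th, S th -> exists2 i, i \in s & C i th) ->
  (forall i, finite_on P (S `&` C i)) -> finite_on P S.
Proof.
move=> Scov /choice[t tP]; exists (flatten [seq t i | i <- s]) => th Sth.
have [i is_ Ci] := Scov th Sth; have [w wt thw] := tP i th (conj Sth Ci).
by exists w => //; apply/flatten_mapP; exists i.
Qed.

(** The fiber is cut into finitely many classes by the first component of [M1], a divisor of a fixed
    polynomial. Within a class, [node_unique] makes the equations of [M1] and [M2] constant up to
    scale, and induction applies to both. *)
Lemma finite_same_eqn M th : num_coef M = size (params M) -> param_space th ->
  coprimep (gen (env th) M).1 (gen (env th) M).2 ->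
  finite_on (params M) (same_eqn M th).
Proof.
move=> nM; move: nM th; elim/conn_ind: M => [j|k|b M1 M2 IH1 IH2] nM th th0.
- move=> _; exists [:: th] => th' [_ [c c0 [E1 E2]]].
  exists th; rewrite ?inE// => p; rewrite inE => /eqP ->.
  move: E2 E1; rewrite /= -mul_polyC mulr1 -polyC1 => /polyC_inj <-.
  by rewrite scale1r => /polyC_inj.
- move=> _; exists [:: th] => th' [_ [c c0 [E1 E2]]].
  exists th; rewrite ?inE// => p; rewrite inE => /eqP ->.
  move: E2 E1; rewrite /= -mul_polyC mulr1 -polyC1 => /polyC_inj <-.
  by rewrite scale1r => /polyC_inj.
have /eqP := nM; rewrite num_coef_conn_eq => /and3P[/eqP n1 /eqP n2 good12] cop.
pose g th i := orient b (gen (env th) (if i then M1 else M2)).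
pose nd th := node (node_shift b M1 M2) (node_shift b M2 M1) (g th true) (g th false).
have ndE th' : nd th' = orient b (gen (env th') (conn b M1 M2)).
  by rewrite gen_conn orientK.
have fg th' i : param_space th' ->
    full_pair (orient b (deg (if i then M1 else M2))) (g th' i).
  by move=> th'0; apply/full_orient/full_gen/env_gt0.
have cop_orient (p : {poly R} * {poly R}) :
    coprimep (orient b p).1 (orient b p).2 = coprimep p.1 p.2.
  by case: b {good12 g nd ndE fg nM cop}; rewrite //= coprimep_sym.
have nd1 th' : param_space th' -> (nd th').1 != 0.
  by move=> th'0; rewrite mulf_neq0 ?(full_neq0 (fg _ _ th'0).1).
have [s sP] := finitely_many_divisors (nd1 _ th0).
apply: (finite_on_cover (s := s) (C := fun u => [set th' | (g th' true).1 %= u])).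
  move=> th' [th'0 /(proportional_orient b) [c c0]]; rewrite -!ndE => -[E _].
  apply: sP; rewrite -(dvdpZr _ _ c0) -E /nd /node /=; exact: dvdp_mulr.
move=> u; have [[th'' [[th''0 prop''] u'']]|no] :=
    pselect (exists th'', (same_eqn (conn b M1 M2) th `&`
      [set th' | (g th' true).1 %= u]) th''); last by exists [::] => th' H; case: no; exists th'.
(* Coprimality depends on the equation only, so it passes from [th] to the representative [th''] of
   the class, and from there to both parts by [coprime_node]. *)
have cop'' : coprimep (nd th'').1 (nd th'').2.
  have [c c0 E] := prop''; rewrite ndE cop_orient E /scale /=.
  by rewrite coprimepZl// coprimepZr.
move: cop''; rewrite (coprime_node _ _ (fg _ true th''0) (fg _ false th''0)).
rewrite !cop_orient => /and3P[cop12 cop1 cop2].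
have [t1 t1P] := IH1 n1 _ th''0 cop1; have [t2 t2P] := IH2 n2 _ th''0 cop2.
exists [seq splice (params M1) w1 w2 | w1 <- t1, w2 <- t2].
move=> th' [[th'0 prop'] u'].
have [k k0 E] : proportional (nd th') (nd th'').
  rewrite !ndE; apply/proportional_orient.
  exact: proportional_trans prop' (proportional_sym prop'').
have u'u'' : (g th' true).1 %= (g th'' true).1.
  by apply: eqp_trans u' _; rewrite eqp_sym.
have [[c1 c2] /= [c10 c20] [E1 E2]] := node_unique (fg _ true th''0)
  (fg _ true th'0) (fg _ false th''0) (fg _ false th'0) (sh_le1 _ _ _) good12
  cop12 k0 E u'u''.
have [|w1 w1t tw1] := t1P th'.
  by split=> //; apply/(proportional_orient b); exists c1.
have [|w2 w2t tw2] := t2P th'.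
  by split=> //; apply/(proportional_orient b); exists c2.
exists (splice (params M1) w1 w2); first exact: allpairs_f.
move=> p; rewrite params_conn mem_cat env_splice; case: ifP => [p1 _|_ /= p2].
  exact: tw1.
exact: tw2.
Qed.

End Fiber.

(** * Openness and infinite fibers *)

(** The completeness that [banach_fixed_point] requires of the space of row vectors. *)
HB.instance Definition _ (R : realType) m n := Complete.on 'M[R]_(m, n).

Section Open.
Variable R : realType.

Lemma coord_le_norm n (x : 'rV[R]_n) i : `|x 0 i| <= `|x|.
Proof.
rewrite /Num.Def.normr /= mx_normrE; apply/bigmax_geP; right.
by exists (0, i).
Qed.

Lemma norm_le_coord n (x : 'rV[R]_n) c : 0 <= c ->
  (forall i, `|x 0 i| <= c) -> `|x| <= c.
Proof.
move=> c0 xc; rewrite /Num.Def.normr /= mx_normrE; apply/bigmax_leP.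
by split=> // -[i j] _ /=; rewrite ord1.
Qed.

(** A solution is a fixed point of x |-> w - Q x. On the ball of radius s with K s <= 1/4 this map
    has Lipschitz constant 1/2, and it preserves the ball when |w| <= s / 2. *)
Lemma quadratic_solve n (Q : 'rV[R]_n -> 'rV[R]_n) (K : R) : 0 <= K ->
  Q 0 = 0 -> (forall x y, `|Q x - Q y| <= K * (`|x| + `|y|) * `|x - y|) ->
  forall r, 0 < r -> exists2 d, 0 < d & forall w, `|w| <= d ->
    exists2 x, `|x| <= r & x + Q x = w.
Proof.
move=> K0 Q0 QK r r0; pose s := Num.min r (4^-1 / (K + 1)).
have K1 : 0 < K + 1 by rewrite ltr_wpDl.
have s0 : 0 < s by rewrite lt_min r0 divr_gt0.
have Ks : K * s <= 4^-1.
  have : s <= 4^-1 / (K + 1) by rewrite ge_min lexx orbT.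
  rewrite ler_pdivlMr// => H; apply: le_trans H; rewrite mulrC ler_wpM2l ?ltW//.
  by rewrite ltrDl.
exists (s / 2) => [|w ws]; first by rewrite divr_gt0.
pose U := [set x : 'rV[R]_n | `|x| <= s].
have fU : {homo (fun x => w - Q x) : x / U x}.
  move=> x; rewrite /U /= => xs; apply: le_trans (ler_normB _ _) _.
  have := QK x 0; rewrite Q0 !subr0 normr0 addr0 => Qx.
  have : K * `|x| * `|x| <= 4^-1 * s.
    by apply: ler_pM => //; rewrite ?mulr_ge0//; apply: le_trans Ks; rewrite ler_wpM2l.
  by lra.
have ctr : is_contraction (mkfun_fun fU : {fun U >-> U}).
  exists (2^-1)%:nng; split=> /=; first by rewrite invf_lt1// ltr1n.
  move=> [x y] [/= xs ys]; rewrite opprB addrCA addrAC subrr add0r -normrN opprB.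
  apply: le_trans (QK x y) _; rewrite ler_wpM2r//.
  have : K * (`|x| + `|y|) <= K * (s + s) by rewrite ler_wpM2l// lerD.
  by rewrite mulrDr; lra.
have [||x xU xE] := banach_fixed_point ctr.
- have := @closed_closed_ball_ _ 'rV[R]_n 0 s.
  by congr closed; apply/seteqP; split=> y; rewrite /closed_ball_/= sub0r normrN.
- by exists 0; rewrite /U/= normr0 ltW.
exists x; first by apply: le_trans xU _; rewrite ge_min lexx.
by rewrite {1}xE /= subrK.
Qed.

Lemma linear_bound m n (f : 'rV[R]_m -> 'rV[R]_n) : linear f ->
  exists2 K, 0 <= K & forall x, `|f x| <= K * `|x|.
Proof.
move=> lf; exists (\sum_i `|f (delta_mx 0 i)|); first exact: sumr_ge0.
have f0 : f 0 = 0 by have := lf (-1) 0 0; rewrite !scaleN1r oppr0 addr0 addNr.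
have fD : {morph f : x y / x + y >-> x + y}.
  by move=> x y; have := lf 1 x y; rewrite !scale1r.
move=> x; rewrite [in f x](row_sum_delta x) (big_morph f fD f0).
apply: le_trans (ler_norm_sum _ _ _) _; rewrite mulr_suml.
apply: ler_sum => i _; rewrite -[_ *: _]addr0 lf f0 addr0 normrZ mulrC.
by rewrite ler_wpM2l// coord_le_norm.
Qed.

Lemma bilinear_bound m n p (f : 'rV[R]_m -> 'rV[R]_n -> 'rV[R]_p) :
  (forall x, linear (f x)) -> (forall y, linear (f^~ y)) ->
  exists2 K, 0 <= K & forall x y, `|f x y| <= K * `|x| * `|y|.
Proof.
move=> lr ll.
have /choice[K KP] (j : 'I_n) : exists K, 0 <= K /\
    forall x, `|f x (delta_mx 0 j)| <= K * `|x|.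
  by have [K K0 KP] := linear_bound (ll (delta_mx 0 j)); exists K.
exists (\sum_j K j); first by apply: sumr_ge0 => j _; have [] := KP j.
move=> x y; have f0 : f x 0 = 0.
  by have := lr x (-1) 0 0; rewrite !scaleN1r oppr0 addr0 addNr.
have fD : {morph f x : u v / u + v >-> u + v}.
  by move=> u v; have := lr x 1 u v; rewrite !scale1r.
rewrite [in f x y](row_sum_delta y) (big_morph (f x) fD f0).
apply: le_trans (ler_norm_sum _ _ _) _; rewrite !mulr_suml.
apply: ler_sum => i _; rewrite -[_ *: _]addr0 lr f0 addr0 normrZ mulrC.
by apply: ler_pM => //; [have [] := KP i|exact: coord_le_norm].
Qed.

Lemma coef_bound m n (f : 'rV[R]_m -> {poly R}) : linear f ->
  (forall x, (size (f x) <= n)%N) ->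
  exists2 K, 0 <= K & forall x i, `|(f x)`_i| <= K * `|x|.
Proof.
move=> lf sf; have lpf : linear (fun x => poly_rV (f x) : 'rV[R]_n).
  by move=> a x y; rewrite lf linearP.
have [K K0 KP] := linear_bound lpf; exists K => // x i.
have [ni|ni] := leqP n i.
  by rewrite nth_default ?normr0 ?mulr_ge0// (leq_trans (sf x)).
have := le_trans (coord_le_norm (poly_rV (f x)) (Ordinal ni)) (KP x).
by rewrite mxE.
Qed.

(** A linear right inverse of (V, U) |-> P V + Q U with control of degrees: U is a Bezout solution
    reduced modulo P, and the size of V is read off from P V = h - Q U. *)
Lemma bezout_solver (P Q : {poly R}) a b : coprimep P Q ->
  size P = a.+1 -> size Q = b.+1 ->
  exists U V : {poly R} -> {poly R}, [/\ linear U, linear V,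
    forall h, P * V h + Q * U h = h, forall h, (size (U h) <= a)%N &
    forall (h : {poly R}) m, (size h <= m)%N -> (size (V h) <= maxn (m - a) b)%N].
Proof.
move=> /Bezout_eq1_coprimepP[[v u] /= uv] sP sQ.
have P0 : P != 0 by rewrite -size_poly_eq0 sP.
pose U h := (h * u) %% P; pose V h := (h - Q * U h) %/ P.
have lU : linear U.
  by move=> c x y; rewrite /U mulrDl -scalerAl modpD modpZl.
have sU h : (size (U h) <= a)%N by rewrite -ltnS -sP ltn_modp.
have PV h : P * V h = h - Q * U h.
  rewrite /V mulrC divpK// /U (_ : h - _ = h * v * P + Q * ((h * u) %/ P) * P).
    by rewrite -mulrDl dvdp_mulIr.
  have -> : h * v * P = h - h * u * Q.
    by rewrite -!mulrA -[X in X - _]mulr1 -mulrBr -uv addrK.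
  rewrite {2}(divp_eq (h * u) P); ring.
exists U, V; split => //.
- move=> c x y; rewrite /V lU (_ : _ - _ = c *: (x - Q * U x) + (y - Q * U y)).
    by rewrite divpD divpZl.
  by rewrite -!mul_polyC; ring.
- by move=> h; rewrite PV subrK.
move=> h m hm; have [V0|V0] := eqVneq (V h) 0; first by rewrite V0 size_poly0.
have : (size (P * V h)%R <= maxn m (a + b))%N.
  rewrite PV; apply: leq_trans (size_polyD _ _) _; rewrite size_polyN geq_max.
  rewrite leq_max hm /= leq_max; apply/orP; right.
  apply: leq_trans (size_polyMleq _ _) _.
  by rewrite sQ addSn addnC leq_add2r.
rewrite size_mul// sP addSn; move: (size (V h)) => sV; lia.
Qed.
End Open.

(** * Openness of the connection map *)

Section NodeOpen.
Variable R : realType.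

Definition close_pair (e : R) (p q : {poly R} * {poly R}) :=
  forall i, `|p.1`_i - q.1`_i| <= e /\ `|p.2`_i - q.2`_i| <= e.

Definition size_pair (d : nat * nat) (p : {poly R} * {poly R}) :=
  (size p.1 <= d.1.+1)%N /\ (size p.2 <= d.2.+1)%N.

Lemma full_size_pair d p : full_pair d p -> size_pair d p.
Proof. by move=> [f1 f2]; split; rewrite (full_size f1, full_size f2). Qed.

Lemma cross_solver al be d e (p q : {poly R} * {poly R}) :
    full_pair d p -> full_pair e q -> (al + be <= 1)%N ->
    (al + d.1 <= d.2.+1)%N -> (be + e.1 <= e.2.+1)%N -> coprimep p.1 q.1 ->
  exists W Y : {poly R} -> {poly R}, [/\ linear W, linear Y,
    forall g, 'X^al * (p.1 * Y g) + 'X^be * (W g * q.1) = g &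
    forall g : {poly R}, (size g <= (deg_node al be d e).2.+1)%N ->
      (size (W g) <= d.2.+1)%N /\ (size (Y g) <= e.2.+1)%N].
Proof.
move=> [fp _] [fq _] ab kl1 kl2 cop.
have szX k n (u : {poly R}) : full n u -> size ('X^k * u) = (k + n).+1.
  by move=> fu; rewrite mulrC size_mulXn ?(full_neq0 fu)// (full_size fu) addnS.
have copX : coprimep ('X^al * p.1) ('X^be * q.1).
  rewrite coprimepMl !coprimepMr cop [coprimep p.1 'X^be]coprimep_sym.
  rewrite (coprimep_Xn _ fq) (coprimep_Xn _ fp) !andbT.
  by case: al be ab {kl1 kl2} => [|[|//]] [|[|//]] // _;
    rewrite ?expr0 ?coprime1p ?coprimep1.
(* The modulus is taken from the term with the larger degree bound, so that the quotient, whose size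
   grows with that of [g], remains within its bound. *)
have [le|/ltnW le] := leqP (be + (d.2 + e.1)) (al + (d.1 + e.2)).
  have [U [V [lU lV UV sU sV]]] := bezout_solver copX (szX _ _ _ fp) (szX _ _ _ fq).
  exists U, V; split=> // g; rewrite /deg_node /=.
    by rewrite -[RHS]UV; ring.
  move=> /sV sVg; split; first by apply: leq_trans (sU g) _.
  by apply: leq_trans sVg _; lia.
have copX' := copX; rewrite coprimep_sym in copX'.
have [U [V [lU lV UV sU sV]]] := bezout_solver copX' (szX _ _ _ fq) (szX _ _ _ fp).
exists V, U; split=> // g; rewrite /deg_node /=.
  by rewrite -[RHS]UV; ring.
move=> /sV sVg; split; last by apply: leq_trans (sU g) _.
by apply: leq_trans sVg _; lia.
Qed.

(* The increment of node at (p, q) is a surjective linear map plus a quadratic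
   one, so that small values of the increment are attained. *)
Lemma node_open al be d e (p q : {poly R} * {poly R}) :
    full_pair d p -> full_pair e q -> (al + be <= 1)%N ->
    (al + d.1 <= d.2.+1)%N -> (be + e.1 <= e.2.+1)%N -> coprimep p.1 q.1 ->
  forall r, 0 < r -> exists2 s, 0 < s & forall t,
    size_pair (deg_node al be d e) t -> close_pair s t (node al be p q) ->
  exists p' q', [/\ size_pair d p', size_pair e q', close_pair r p' p,
    close_pair r q' q & node al be p' q' = t].
Proof.
move=> fp fq ab kl1 kl2 cop r r0.
have [szp szq] := (full_size_pair fp, full_size_pair fq).
have szn := full_size_pair (full_node ab fp fq).
have [W [Y [lW lY WY sWY]]] := cross_solver fp fq ab kl1 kl2 cop.
have [U [V [lU lV UV sU sV]]] :=
  bezout_solver cop (full_size fp.1) (full_size fq.1).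
pose n1 := (deg_node al be d e).1.+1; pose n2 := (deg_node al be d e).2.+1.
(* A row [k] encodes a wanted increment ([h1 k], [h2 k]) of [node]. The increments [u], [w] of [p]
   and [v], [y] of [q] produce it to first order; [g] is what [w] and [y] must supply after [u] and
   [v]. *)
pose h1 (k : 'rV[R]_(n1 + n2)) := rVpoly (lsubmx k).
pose h2 (k : 'rV[R]_(n1 + n2)) := rVpoly (rsubmx k).
have lh1 : linear h1 by move=> a x y; rewrite /h1 !linearP.
have lh2 : linear h2 by move=> a x y; rewrite /h2 !linearP.
pose u k := U (h1 k); pose v k := V (h1 k).
pose g k := h2 k - 'X^al * (u k * q.2) - 'X^be * (p.2 * v k).
pose w k := W (g k); pose y k := Y (g k).
have lu : linear u by move=> a x z; rewrite /u lh1 lU.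
have lv : linear v by move=> a x z; rewrite /v lh1 lV.
have lg : linear g.
  by move=> a x z; rewrite /g lh2 lu lv -!mul_polyC; ring.
have lw : linear w by move=> a x z; rewrite /w lg lW.
have ly : linear y by move=> a x z; rewrite /y lg lY.
have su k : (size (u k) <= d.1.+1)%N by rewrite ltnW// ltnS sU.
have sv k : (size (v k) <= e.1.+1)%N.
  have /sV : (size (h1 k) <= n1)%N by exact: size_poly.
  by move=> H; apply: leq_trans H _; rewrite /n1 /=; lia.
have n2al (a b : {poly R}) : (size a <= d.1.+1)%N -> (size b <= e.2.+1)%N ->
    (size ('X^al * (a * b))%R <= n2)%N.
  move=> sa sb; apply: leq_trans (size_Xn_mul_le _ (size_mul_le sa sb)) _.
  by rewrite ltnS leq_max leqnn.
have n2be (a b : {poly R}) : (size a <= d.2.+1)%N -> (size b <= e.1.+1)%N ->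
    (size ('X^be * (a * b))%R <= n2)%N.
  move=> sa sb; apply: leq_trans (size_Xn_mul_le _ (size_mul_le sa sb)) _.
  by rewrite ltnS leq_max leqnn orbT.
have sg k : (size (g k) <= n2)%N.
  rewrite /g; apply: size_add_le; last by rewrite size_polyN n2be// szp.2.
  apply: size_add_le; first exact: size_poly.
  by rewrite size_polyN n2al// szq.2.
have sw k : (size (w k) <= d.2.+1)%N by have [] := sWY _ (sg k).
have sy k : (size (y k) <= e.2.+1)%N by have [] := sWY _ (sg k).
(* The second-order part of the increment of [node], as a bilinear map on rows. *)
pose B (k l : 'rV[R]_(n1 + n2)) : 'rV[R]_(n1 + n2) :=
  row_mx (poly_rV (u k * v l))
         (poly_rV ('X^al * (u k * y l) + 'X^be * (w k * v l))).
have lB1 k : linear (B k).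
  move=> a l m; rewrite /B lv ly -[RHS]/(_ + _) scale_row_mx add_row_mx.
  by congr row_mx; rewrite -linearP; congr poly_rV; rewrite -!mul_polyC; ring.
have lB2 l : linear (B^~ l).
  move=> a k m; rewrite /B lu lw scale_row_mx add_row_mx.
  by congr row_mx; rewrite -linearP; congr poly_rV; rewrite -!mul_polyC; ring.
have [C C0 BC] := bilinear_bound lB1 lB2.
have BB k l : B k k - B l l = B k (k - l) + B (k - l) l.
  have := lB1 k (-1) l k; have := lB2 l (-1) l k.
  rewrite !scaleN1r ![- l + k]addrC => -> ->.
  by rewrite [- B k l + _]addrC addrA [X in _ = X]addrAC subrK.
have B0 : B 0 0 = 0.
  by have := lB1 0 (-1) 0 0; rewrite !scaleN1r oppr0 addr0 addNr.
have Bq k l : `|B k k - B l l| <= C * (`|k| + `|l|) * `|k - l|.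
  rewrite BB mulrDr mulrDl; apply: le_trans (ler_normD _ _) _.
  by apply: lerD; rewrite ?BC// -mulrA [`|l| * _]mulrC mulrA BC.
have [Ku Ku0 uK] := coef_bound lu su; have [Kv Kv0 vK] := coef_bound lv sv.
have [Kw Kw0 wK] := coef_bound lw sw; have [Ky Ky0 yK] := coef_bound ly sy.
pose Kt := Ku + Kv + Kw + Ky + 1.
have Kt0 : 0 < Kt by rewrite ltr_wpDl// !addr_ge0.
have [s s0 solve] := quadratic_solve (Q := fun k => B k k) C0 B0 Bq (divr_gt0 r0 Kt0).
exists s => // t szt tn.
pose z : 'rV[R]_(n1 + n2) := row_mx (poly_rV (t.1 - (node al be p q).1))
                                   (poly_rV (t.2 - (node al be p q).2)).
have [|k kr kz] := solve z.
  apply: norm_le_coord => [|i]; first exact: ltW.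
  rewrite /z; case: (split_ordP i) => j ->;
    by rewrite ?row_mxEl ?row_mxEr mxE coefB; have [] := tn j.
have krK a i (f : 'rV[R]_(n1 + n2) -> {poly R}) : a <= Kt ->
    (forall x i, `|(f x)`_i| <= a * `|x|) -> `|(f k)`_i| <= r.
  move=> aK fK; apply: le_trans (fK k i) _.
  apply: (@le_trans _ _ (Kt * `|k|)); first by rewrite ler_wpM2r.
  by move: kr; rewrite ler_pdivlMr// mulrC.
exists (p.1 + u k, p.2 + w k), (q.1 + v k, q.2 + y k); split.
- by split; apply: size_add_le => //=; rewrite ?szp.1 ?szp.2.
- by split; apply: size_add_le => //=; rewrite ?szq.1 ?szq.2.
- move=> i; rewrite /= !coefD ![_ + _ - _]addrAC !subrr !add0r; split.
    by apply: krK uK; rewrite /Kt; lra.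
  by apply: krK wK; rewrite /Kt; lra.
- move=> i; rewrite /= !coefD ![_ + _ - _]addrAC !subrr !add0r; split.
    by apply: krK vK; rewrite /Kt; lra.
  by apply: krK yK; rewrite /Kt; lra.
have h1D x1 x2 : h1 (x1 + x2) = h1 x1 + h1 x2 by rewrite /h1 !linearD.
have h2D x1 x2 : h2 (x1 + x2) = h2 x1 + h2 x2 by rewrite /h2 !linearD.
have F1 : h1 k + u k * v k = t.1 - (node al be p q).1.
  have -> : u k * v k = h1 (B k k).
    by rewrite /h1 /B row_mxKl poly_rV_K// size_mul_le.
  rewrite -h1D kz /h1 /z row_mxKl poly_rV_K// size_add_le ?size_polyN ?szt.1//.
  exact: szn.1.
have F2 : h2 k + ('X^al * (u k * y k) + 'X^be * (w k * v k)) =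
    t.2 - (node al be p q).2.
  have -> : 'X^al * (u k * y k) + 'X^be * (w k * v k) = h2 (B k k).
    by rewrite /h2 /B row_mxKr poly_rV_K// size_add_le// ?n2al ?n2be.
  rewrite -h2D kz /h2 /z row_mxKr poly_rV_K// size_add_le ?size_polyN ?szt.2//.
  exact: szn.2.
rewrite /node /= [RHS]surjective_pairing; congr pair.
  have -> : t.1 = (node al be p q).1 + (h1 k + u k * v k) by rewrite F1 addrC subrK.
  by rewrite -(UV (h1 k)) /node /= -/(u k) -/(v k); ring.
have -> : t.2 = (node al be p q).2 + (h2 k + ('X^al * (u k * y k) + 'X^be * (w k * v k))).
  by rewrite F2 addrC subrK.
have -> : h2 k = g k + 'X^al * (u k * q.2) + 'X^be * (p.2 * v k) by rewrite /g; ring.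
rewrite -{1}(WY (g k)) -/(w k) -/(y k) /node /=; ring.
Qed.
End NodeOpen.

(** * Realization by positive parameters and infinite fibers *)

Section Realize.
Variables (R : realType) (N K : nat).
Implicit Types (M : tree N K) (th : 'rV[R]_(N + K)).

Lemma close_pair_orient b s (p q : {poly R} * {poly R}) :
  close_pair s (orient b p) (orient b q) <-> close_pair s p q.
Proof. by case: b; split=> H i; have [] := H i. Qed.

Lemma size_pair_orient b d (p : {poly R} * {poly R}) :
  size_pair (orient b d) (orient b p) <-> size_pair d p.
Proof. by case: b; split=> -[]. Qed.

Lemma same_gen_splice M1 M2 th1 th2 th : is_network (conn true M1 M2) ->
  gen (env (splice (params M1) th1 (splice (params M2) th2 th))) M1 = gen (env th1) M1
  /\ gen (env (splice (params M1) th1 (splice (params M2) th2 th))) M2 = gen (env th2) M2.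
Proof.
move=> /and3P[_ _ dis]; split; apply: eq_gen => p pM; rewrite !env_splice ?pM//.
by rewrite ifN//; apply: contra dis => p1; apply/hasP; exists p.
Qed.

(** Constants (u, v) within [s] of (a, 1) are positive, hence proportional to (u / v, 1), the
    equation of an element with parameter u / v. *)
Lemma realize_leaf (f : 'rV[R]_(N + K) -> {poly R} * {poly R}) (a : R) :
  0 < a -> (forall c, 0 < c -> f (const_mx c) = (c%:P, 1)) ->
  exists2 s, 0 < s & forall t, size_pair (0, 0)%N t ->
    close_pair s t (a%:P, 1) ->
    exists2 th', param_space th' & proportional (f th') t.
Proof.
move=> a0 fE; pose s := Num.min a 1 / 2.
have [sa s1] : s < a /\ s < 1.
  have : Num.min a 1 <= a /\ Num.min a 1 <= 1 by rewrite !ge_min !lexx orbT.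
  have : 0 < Num.min a 1 by rewrite lt_min a0 ltr01.
  by rewrite /s; lra.
exists s; first by rewrite divr_gt0// lt_min a0 ltr01.
move=> [u v] [/= /size1_polyC -> /size1_polyC ->].
move: (u`_0) (v`_0) => {u v} u v /(_ 0%N) /=.
rewrite coef1 !coefC /= !ler_norml => -[/andP[a1 _] /andP[b1 _]].
have v0 : 0 < v by lra.
exists (const_mx (u / v)); first by move=> i; rewrite mxE divr_gt0//; lra.
exists v^-1; first by rewrite invr_eq0 gt_eqF.
rewrite fE ?divr_gt0//; last lra.
by rewrite /scale /= -!mul_polyC -!polyCM mulVf ?gt_eqF// mulrC.
Qed.

(** [node_open] splits a target near the equation into targets near those of the parts. Induction
    realizes these, and disjointness of the parameters lets the two solutions be spliced. *)
Lemma realize_open M th : is_network M -> param_space th -> generic (env th) M ->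
  exists2 s, 0 < s & forall t, size_pair (deg M) t ->
    close_pair s t (gen (env th) M) ->
    exists2 th', param_space th' & proportional (gen (env th') M) t.
Proof.
move=> + th0; elim/conn_ind: M => [j _ _|k _ _|b M1 M2 IH1 IH2].
- apply: realize_leaf; first exact: env_gt0.
  by move=> c c0; rewrite /= /env mxE.
- apply: realize_leaf; first exact: env_gt0.
  by move=> c c0; rewrite /= /env mxE.
move=> netM; have := netM; rewrite is_network_conn => /and3P[net1 net2 _].
rewrite generic_conn => /and3P[/(IH1 net1)[s1 s10 H1] /(IH2 net2)[s2 s20 H2] cop].
have f1 := (full_orient b _ _).2 (full_gen M1 (env_gt0 th0)).
have f2 := (full_orient b _ _).2 (full_gen M2 (env_gt0 th0)).
have r0 : 0 < Num.min s1 s2 by rewrite lt_min s10.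
have [s s0 H] := node_open f1 f2 (sh_le1 b M1 M2) (sh_lt b M1 M2) (sh_lt b M2 M1)
  cop r0.
exists s => // t; rewrite deg_conn gen_conn -[t](orientK b).
move=> /(size_pair_orient b) szt /close_pair_orient nt.
have [p [q [szp szq np nq E]]] := H _ szt nt.
have near_le r r' (u u' : {poly R} * {poly R}) : r <= r' ->
    close_pair r u u' -> close_pair r' u u'.
  by move=> rr' nu i; have [? ?] := nu i; split; apply: le_trans rr'.
have [||th1 th10 g1] := H1 (orient b p).
- by apply/(size_pair_orient b); rewrite orientK.
- apply/(close_pair_orient b); rewrite orientK; apply: near_le np.
  by rewrite ge_min lexx.
have [||th2 th20 g2] := H2 (orient b q).
- by apply/(size_pair_orient b); rewrite orientK.
- apply/(close_pair_orient b); rewrite orientK; apply: near_le nq.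
  by rewrite ge_min lexx orbT.
exists (splice (params M1) th1 (splice (params M2) th2 th)).
  by do !apply: splice_gt0.
rewrite gen_conn; apply/proportional_orient; rewrite -E.
have [|-> ->] := @same_gen_splice M1 M2 th1 th2 th.
  by rewrite is_network_conn -(is_network_conn b).
by apply: proportional_node; apply/(proportional_orient b); rewrite orientK.
Qed.

(** Freezing the parameters outside [M] lets an infinite fiber of a subnetwork embed into that of
    the whole network. *)
Definition local_same_eqn M th := same_eqn M th `&`
  [set th' | forall p, p \notin params M -> env th' p = env th p].

Lemma local_same_eqn_sub b M1 M2 th : is_network (conn b M1 M2) ->
  local_same_eqn M1 th `|` local_same_eqn M2 th `<=`
  local_same_eqn (conn b M1 M2) th.
Proof.
rewrite is_network_conn => /and3P[_ _ dis] th' H.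
have [i [Hi Hni]] : exists i, local_same_eqn (if i then M1 else M2) th th' /\
    {in params (if i then M2 else M1), env th' =1 env th}.
  case: H => H; [exists true|exists false]; split=> // p pM; apply: H.2.
    by apply: contra dis => p1; apply/hasP; exists p.
  by apply: contra dis => p1; apply/hasP; exists p.
case: Hi => -[th'0 prop] off; split; first split => //.
  rewrite !gen_conn; apply/proportional_orient/proportional_node;
    apply/proportional_orient; case: i prop Hni {off} => // _ /eq_gen ->;
    by exists 1; rewrite ?oner_neq0// /scale !scale1r; case: (gen _ _).
move=> p; rewrite params_conn mem_cat negb_or => /andP[p1 p2].
by apply: off; case: (i).
Qed.

Lemma poly_coef_bound (a : {poly R}) : exists2 C, 0 <= C & forall i, `|a`_i| <= C.
Proof.
exists (\sum_(i < size a) `|a`_i|) => [|i]; first exact: sumr_ge0.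
have [ia|ia] := ltnP i (size a); last by rewrite nth_default ?normr0// sumr_ge0.
by rewrite (bigD1 (Ordinal ia))//= lerDl sumr_ge0.
Qed.

Lemma infinite_same_eqn M th : is_network M -> param_space th ->
  generic (env th) M -> num_coef M != size (params M) ->
  ~ finite_set (local_same_eqn M th).
Proof.
move=> + th0; elim/conn_ind: M => [//|//|b M1 M2 IH1 IH2].
move=> netM; have := netM; rewrite is_network_conn => /and3P[net1 net2 dis].
move=> gM; have := gM; rewrite generic_conn num_coef_conn_eq !negb_and.
move=> /and3P[g1 g2 cop] /or3P[n1|n2|].
- move=> fin; apply: (IH1 net1 g1 n1); apply: sub_finite_set fin => th' H.
  by apply: local_same_eqn_sub => //; left.
- move=> fin; apply: (IH2 net2 g2 n2); apply: sub_finite_set fin => th' H.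
  by apply: local_same_eqn_sub => //; right.
rewrite /good_node negb_or -!leqNgt => /andP[le1 le2].
have [s1 s10 H1] := realize_open net1 th0 g1.
have [s2 s20 H2] := realize_open net2 th0 g2.
have f1 := (full_orient b _ _).2 (full_gen M1 (env_gt0 th0)).
have f2 := (full_orient b _ _).2 (full_gen M2 (env_gt0 th0)).
set al := node_shift b M1 M2 in le1; set be := node_shift b M2 M1 in le2.
set p := orient b (gen (env th) M1) in f1; set q := orient b (gen (env th) M2) in f2.
set d := orient b (deg M1) in le1 f1; set e := orient b (deg M2) in le2 f2.
have [C1 C10 C1P] := poly_coef_bound ('X^al * p.1).
have [C2 C20 C2P] := poly_coef_bound ('X^be * q.1).
(* Distinct positive numbers, small enough for the perturbations below to stay within [s1] and
   [s2]. *)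
pose eps (n : nat) : R := Num.min s1 s2 / (C1 + C2 + 1) / n.+1%:R.
have C0 : 0 < C1 + C2 + 1 by rewrite ltr_wpDl// addr_ge0.
have s0 : 0 < Num.min s1 s2 by rewrite lt_min s10.
have eps0 n : 0 < eps n by rewrite !divr_gt0.
have epsC n C : 0 <= C -> C <= C1 + C2 + 1 -> eps n * C <= Num.min s1 s2.
  move=> C_ge0 CC; rewrite /eps mulrAC ler_pdivrMr// mulrAC ler_pdivrMr//.
  rewrite -mulrA; apply: ler_wpM2l; first exact: ltW.
  by apply: le_trans CC _; rewrite ler_peMl ?ler1n// ltW.
(* The two perturbations cancel in [node]; they respect the sizes [d] and [e] because [le1] and
   [le2] deny additivity. *)
pose p' n := (p.1, p.2 + eps n *: ('X^al * p.1)).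
pose q' n := (q.1, q.2 - eps n *: ('X^be * q.1)).
have nodeE n : node al be (p' n) (q' n) = node al be p q.
  by rewrite /node /p' /q' /= -!mul_polyC; congr pair; ring.
have szp n : size_pair d (p' n).
  split; first by rewrite (full_size f1.1).
  apply: size_add_le; first by rewrite (full_size f1.2).
  apply: leq_trans (size_scale_leq _ _) _.
  apply: leq_trans (size_Xn_mul_le _ (_ : size p.1 <= d.1.+1)%N) _ => //.
  by rewrite (full_size f1.1).
have szq n : size_pair e (q' n).
  split; first by rewrite (full_size f2.1).
  apply: size_add_le; first by rewrite (full_size f2.2).
  rewrite size_polyN; apply: leq_trans (size_scale_leq _ _) _.
  apply: leq_trans (size_Xn_mul_le _ (_ : size q.1 <= e.1.+1)%N) _ => //.
  by rewrite (full_size f2.1).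
have np n : close_pair s1 (p' n) p.
  move=> i; rewrite /= subrr normr0 ltW// coefD addrAC subrr add0r coefZ; split=> //.
  rewrite normrM (gtr0_norm (eps0 n)).
  apply: (@le_trans _ _ (eps n * C1)); first by rewrite ler_wpM2l// ltW.
  by apply: le_trans (epsC _ _ _ _) _; rewrite // ?ge_min ?lexx//; lra.
have nq n : close_pair s2 (q' n) q.
  move=> i; rewrite /= subrr normr0 ltW// coefB addrAC subrr add0r coefZ; split=> //.
  rewrite normrN normrM (gtr0_norm (eps0 n)).
  apply: (@le_trans _ _ (eps n * C2)); first by rewrite ler_wpM2l// ltW.
  by apply: le_trans (epsC _ _ _ _) _; rewrite // ?ge_min ?lexx ?orbT//; lra.
have /choice[t1 t1P] n : exists th1, param_space th1 /\
    proportional (orient b (gen (env th1) M1)) (p' n).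
  have [||th1 th10 H] := H1 (orient b (p' n)).
  - by apply/(size_pair_orient b); rewrite orientK.
  - by apply/(close_pair_orient b); rewrite orientK.
  by exists th1; split=> //; apply/(proportional_orient b); rewrite orientK.
have /choice[t2 t2P] n : exists th2, param_space th2 /\
    proportional (orient b (gen (env th2) M2)) (q' n).
  have [||th2 th20 H] := H2 (orient b (q' n)).
  - by apply/(size_pair_orient b); rewrite orientK.
  - by apply/(close_pair_orient b); rewrite orientK.
  by exists th2; split=> //; apply/(proportional_orient b); rewrite orientK.
pose f n := splice (params M1) (t1 n) (splice (params M2) (t2 n) th).
have netT : is_network (conn true M1 M2) by rewrite is_network_conn net1 net2.
have fE n := @same_gen_splice M1 M2 (t1 n) (t2 n) th netT.
have f_fiber n : local_same_eqn (conn b M1 M2) th (f n).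
  split; last first.
    move=> i; rewrite params_conn mem_cat negb_or => /andP[i1 i2].
    by rewrite !env_splice (negbTE i1) (negbTE i2).
  split.
    by apply: splice_gt0; [case: (t1P n)|apply: splice_gt0 => //; case: (t2P n)].
  rewrite !gen_conn; apply/proportional_orient; rewrite -/al -/be -/p -/q -(nodeE n).
  rewrite (fE n).1 (fE n).2.
  by apply: proportional_node; [case: (t1P n)|case: (t2P n)].
(* The unchanged first component forces the scalar to be 1, and then the second one determines
   [eps n]. *)
have f_inj : injective f.
  move=> m n fmn; have [_ pm] := t1P m; have [_ pn] := t1P n.
  have [c _ [E1 E2]] : proportional (p' m) (p' n).
    apply: proportional_trans (proportional_sym pm) _.
    by rewrite -(fE m).1 -/(f m) fmn (fE n).1.
  have p10 := full_neq0 f1.1.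
  have c1 : c = 1.
    move/eqP: E1; rewrite -subr_eq0 -{1}[X in X - _]scale1r -scalerBl scaler_eq0.
    by rewrite (negbTE p10) orbF subr_eq0 => /eqP.
  move: E2; rewrite c1 scale1r => /addrI /eqP.
  rewrite -subr_eq0 -scalerBl scaler_eq0 mulf_eq0 (negbTE p10) orbF.
  rewrite expf_eq0 polyX_eq0 andbF orbF subr_eq0 => /eqP.
  move/(mulfI (lt0r_neq0 _)); rewrite divr_gt0// => /(_ isT) /invr_inj/eqP.
  by rewrite eqr_nat eqSS => /eqP.
move=> fin; have : finite_set (range f).
  by apply: sub_finite_set fin => _ [n _ <-]; exact: f_fiber.
move=> /finite_range_cst_subsequence[x [A infA AP]].
have [[a /AP fa]|A0] := pselect (exists a, A a).
  apply: infA; apply: (@sub_finite_set _ _ [set a]) => // m /AP.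
  by rewrite -fa => /f_inj.
apply: infA; apply: (@sub_finite_set _ _ set0) => // m Am.
by apply: A0; exists m.
Qed.
End Realize.

(** * Coefficients of the normalized equation *)

Section Link.
Variables (R : realType) (N K : nat).
Implicit Types (M : tree N K) (th : 'rV[R]_(N + K)) (s : side).

Local Notation A := (mpoly (N + K) R).
Local Notation F := (ratfun R N K).

Definition poly_env (p : 'I_N + 'I_K) : A := mpolyX R (mnm1 (unsplit p)).

Definition frac_env : 'I_N + 'I_K -> F := @tofrac A \o poly_env.

Lemma gen_meval th M :
  map_pair (meval (th 0)) (gen poly_env M) = gen (env th) M.
Proof. by rewrite -map_gen; apply: eq_gen => p _; rewrite /= mevalXU. Qed.

Lemma coef_gen_meval th M i :
  meval (th 0) (gen poly_env M).1`_i = (gen (env th) M).1`_i /\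
  meval (th 0) (gen poly_env M).2`_i = (gen (env th) M).2`_i.
Proof. by rewrite -gen_meval /= !coef_map. Qed.

Lemma coef_gen_gt0 th M i : param_space th ->
  ((i <= (deg M).1)%N -> 0 < meval (th 0) (gen poly_env M).1`_i) /\
  ((i <= (deg M).2)%N -> 0 < meval (th 0) (gen poly_env M).2`_i).
Proof.
move=> th0; have [f1 f2] := full_gen M (env_gt0 th0).
by rewrite !(coef_gen_meval th M i).1 (coef_gen_meval th M i).2;
  split=> ?; [exact: f1.1|exact: f2.1].
Qed.

Lemma ones_gt0 : param_space (const_mx 1 : 'rV[R]_(N + K)).
Proof. by move=> i; rewrite mxE. Qed.

(** A coefficient positive at the point with all parameters 1 is not the zero polynomial. *)
Lemma coef_gen_neq0 M i :
  ((i <= (deg M).1)%N -> (gen poly_env M).1`_i != 0) /\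
  ((i <= (deg M).2)%N -> (gen poly_env M).2`_i != 0).
Proof.
have [H1 H2] := coef_gen_gt0 M i ones_gt0.
by split=> [/H1|/H2]; apply: contraTneq => ->; rewrite meval0 ltxx.
Qed.

Lemma size_gen_poly M : size (gen poly_env M).1 = (deg M).1.+1 /\
  size (gen poly_env M).2 = (deg M).2.+1.
Proof.
have [s1 s2] := size_gen poly_env M; split; apply/eqP; rewrite eqn_leq ?s1 ?s2 /=.
  rewrite ltnNge; apply/negP => /leq_sizeP/(_ _ (leqnn _))/eqP.
  by apply/negP; have [->] := coef_gen_neq0 M (deg M).1.
rewrite ltnNge; apply/negP => /leq_sizeP/(_ _ (leqnn _))/eqP.
by apply/negP; have [_ ->] := coef_gen_neq0 M (deg M).2.
Qed.

Lemma lead_gen_gt0 th M : param_space th ->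
  0 < meval (th 0) (lead_coef (gen poly_env M).1) /\
  0 < meval (th 0) (lead_coef (gen poly_env M).2).
Proof.
move=> th0; rewrite !lead_coefE !(size_gen_poly M).1 (size_gen_poly M).2 /=.
by split; [apply: (coef_gen_gt0 M _ th0).1|apply: (coef_gen_gt0 M _ th0).2].
Qed.

Lemma disc_meval th M : param_space th ->
  (meval (th 0) (disc poly_env M) != 0) = generic (env th) M.
Proof.
move=> th0; rewrite rmorph_disc => [|M']; last first.
  by have [? ?] := lead_gen_gt0 M' th0; split; rewrite gt_eqF.
rewrite disc_neq0 => [|M'].
  by apply: eq_generic => p _ /=; rewrite mevalXU.
rewrite map_gen; have [? ?] := full_gen M' (env_gt0 th0).
by rewrite gen_meval; split; apply: full_neq0; eassumption.
Qed.

Lemma disc_poly_neq0 M : is_network M -> disc poly_env M != 0.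
Proof.
move=> /(exists_generic R)[v v0 gv].
pose th : 'rV[R]_(N + K) := \row_i v (fintype.split i).
have th0 : param_space th by move=> i; rewrite mxE.
have : meval (th 0) (disc poly_env M) != 0.
  rewrite disc_meval// (@eq_generic _ _ _ _ v)// => p _.
  by rewrite /env mxE unsplitK.
by apply: contraNneq => ->; rewrite meval0.
Qed.

Lemma frac_gen M : gen frac_env M = map_pair (@tofrac A) (gen poly_env M).
Proof. exact: map_gen. Qed.

Lemma coef0_frac_gen M : (gen frac_env M).1`_0 != 0 /\ (gen frac_env M).2`_0 != 0.
Proof.
rewrite frac_gen /= !coef_map /= !tofrac_eq0.
by have [H1 H2] := coef_gen_neq0 M 0; split; [exact: H1|exact: H2].
Qed.

(** The polynomial [disc] is nonzero because of a single generic point; so it is nonzero as a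
    fraction, which is genericity of the indeterminates. *)
Lemma frac_generic M : is_network M -> generic frac_env M.
Proof.
move=> netM; rewrite -disc_neq0 => [|M']; last first.
  have [H1 H2] := coef0_frac_gen M'.
  by split; [apply: contraNneq H1 => ->|apply: contraNneq H2 => ->]; rewrite coef0.
rewrite -rmorph_disc => [|M']; first by rewrite tofrac_eq0 disc_poly_neq0.
have [H1 H2] := lead_gen_gt0 M' ones_gt0; rewrite !tofrac_eq0.
by split; [apply: contraTneq H1 => ->|apply: contraTneq H2 => ->];
  rewrite meval0 ltxx.
Qed.

(** Since p and q are coprime and neither vanishes at 0, only X can be a common factor. *)
Lemma gcdp_shifted (L : fieldType) (a1 a2 : bool) (c1 c2 : L) (p q : {poly L}) :
    c1 != 0 -> c2 != 0 -> p`_0 != 0 -> q`_0 != 0 -> coprimep p q ->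
  exists2 k, k != 0 &
    gcdp (c1 *: ('X^a1 * p)) (c2 *: ('X^a2 * q)) = k *: 'X^(a1 && a2).
Proof.
move=> c10 c20 p0 q0 cop.
suff /eqpP[[x y] /= /andP[x0 y0] E] :
    gcdp (c1 *: ('X^a1 * p)) (c2 *: ('X^a2 * q)) %= 'X^(a1 && a2).
  exists (x^-1 * y); first by rewrite mulf_neq0 ?invr_eq0.
  by rewrite -scalerA -E scalerA mulVf// scale1r.
have copX (r : {poly L}) : r`_0 != 0 -> coprimep r 'X.
  move=> r0; have := coprimep_XsubC r 0; rewrite subr0 => ->.
  by rewrite /root horner_coef0.
rewrite (eqp_trans (eqp_gcdl _ (eqp_scale _ c10)))//.
rewrite (eqp_trans (eqp_gcdr _ (eqp_scale _ c20)))//.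
case: a1 a2 => -[]; rewrite /= ?expr1 ?expr0 ?mul1r.
- apply: eqp_trans (_ : 'X * gcdp p q %= _).
    by rewrite eqp_sym; exact: mulp_gcdr.
  by rewrite -[X in _ %= X]mulr1; apply/eqp_mull; rewrite gcdp_eqp1.
- by rewrite gcdp_eqp1 coprimepMl cop coprimep_sym copX.
- by rewrite gcdp_eqp1 coprimepMr cop copX.
- by rewrite gcdp_eqp1.
Qed.

Lemma divp_shifted (L : fieldType) (a1 a2 : bool) (c1 c2 k : L)
    (A1 B1 A2 B2 : {poly L}) : k != 0 ->
  [/\ (c1 *: ('X^a1 * A1) * (c2 *: ('X^a2 * A2))) %/ (k *: 'X^(a1 && a2)) =
      (c1 * c2 / k) *: ('X^(a1 || a2) * (A1 * A2)),
      (c1 *: ('X^a1 * A1) * (c2 *: B2) + c1 *: B1 * (c2 *: ('X^a2 * A2))) %/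
        (k *: 'X^(a1 && a2)) =
      (c1 * c2 / k) *: ('X^(zero_excess a1 a2) * (A1 * B2) + 'X^(zero_excess a2 a1) * (B1 * A2)),
      (c1 *: ('X^a1 * A1) * (c2 *: B2) + c1 *: B1 * (c2 *: ('X^a2 * A2))) %/ (k *: 1) =
      (c1 * c2 / k) *: ('X^(a1 && a2) *
        ('X^(zero_excess a2 a1) * (B1 * A2) + 'X^(zero_excess a1 a2) * (A1 * B2)))
    & (c1 *: B1 * (c2 *: B2)) %/ (k *: 1) = (c1 * c2 / k) *: (B1 * B2)].
Proof.
move=> k0; have kC : c1%:P * c2%:P = (c1 * c2 / k)%:P * k%:P.
  by rewrite -!polyCM divfK.
have X0 n : k *: 'X^n != 0 by rewrite scaler_eq0 negb_or k0 expf_neq0 ?polyX_eq0.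
have X1 := X0 0; rewrite expr0 in X1.
have div (g u t : {poly L}) : g != 0 -> u = t * g -> u %/ g = t.
  by move=> g0 ->; rewrite mulpK.
split; apply: div => //; rewrite -!mul_polyC;
  move: (c1 * c2 / k)%:P c1%:P c2%:P k%:P kC => C C1 C2 D kC;
  case: a1 a2 X0 {X1} => -[] _; rewrite /zero_excess /= ?expr0 ?expr1; ring: kC.
Qed.

Lemma parallel_equation (L : fieldType) (a1 a2 : bool) (c1 c2 : L)
    (A1 B1 A2 B2 : {poly L}) : c1 != 0 -> c2 != 0 -> B1`_0 != 0 -> B2`_0 != 0 ->
    coprimep B1 B2 ->
  exists2 c, c != 0 &
    (let g := gcdp (c1 *: B1) (c2 *: B2) in
     ((c1 *: ('X^a1 * A1) * (c2 *: B2) + c1 *: B1 * (c2 *: ('X^a2 * A2))) %/ g,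
      (c1 *: B1 * (c2 *: B2)) %/ g)) =
    (c *: ('X^(a1 && a2) *
       ('X^(zero_excess a2 a1) * (B1 * A2) + 'X^(zero_excess a1 a2) * (A1 * B2))),
     c *: (B1 * B2)).
Proof.
move=> c10 c20 b1 b2 cop.
have [k k0] := gcdp_shifted false false c10 c20 b1 b2 cop.
rewrite /= expr0 !mul1r => ->; exists (c1 * c2 / k).
  by rewrite !mulf_neq0 ?invr_eq0.
by have [_ _ -> ->] := divp_shifted a1 a2 c1 c2 A1 B1 A2 B2 k0.
Qed.

Lemma series_equation (L : fieldType) (a1 a2 : bool) (c1 c2 : L)
    (A1 B1 A2 B2 : {poly L}) : c1 != 0 -> c2 != 0 -> A1`_0 != 0 -> A2`_0 != 0 ->
    coprimep A1 A2 ->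
  exists2 c, c != 0 &
    (let g := gcdp (c1 *: ('X^a1 * A1)) (c2 *: ('X^a2 * A2)) in
     ((c1 *: ('X^a1 * A1) * (c2 *: ('X^a2 * A2))) %/ g,
      (c1 *: ('X^a1 * A1) * (c2 *: B2) + c1 *: B1 * (c2 *: ('X^a2 * A2))) %/ g)) =
    (c *: ('X^(a1 || a2) * (A1 * A2)),
     c *: ('X^(zero_excess a1 a2) * (A1 * B2) + 'X^(zero_excess a2 a1) * (B1 * A2))).
Proof.
move=> c10 c20 b1 b2 cop.
have [k k0 /= ->] := gcdp_shifted a1 a2 c10 c20 b1 b2 cop.
exists (c1 * c2 / k); first by rewrite !mulf_neq0 ?invr_eq0.
by have [-> -> _ _] := divp_shifted a1 a2 c1 c2 A1 B1 A2 B2 k0.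
Qed.

(** By [frac_generic] each gcd is a power of X up to a scalar, so the recursion with divisions
    follows [gen]; the free scalars of [gcdp] collect in [c]. *)
Lemma constitutive_gen M : is_network M -> exists2 c, c != 0 &
  constitutive R M = (c *: ('X^(zero_root M) * (gen frac_env M).1),
                      c *: (gen frac_env M).2).
Proof.
elim: M => [j|k|M1 IH1 M2 IH2|M1 IH1 M2 IH2] netM.
- exists 1; first exact: oner_neq0.
  rewrite (scale1r (_ * _)) (scale1r (gen _ _).2) mul1r.
  reflexivity.
- exists 1; first exact: oner_neq0.
  rewrite (scale1r (_ * _)) (scale1r (gen _ _).2) [RHS]/= mulrC mul_polyC.
  reflexivity.
- have /and3P[net1 net2 _] := netM; have /and3P[_ _ cop] := frac_generic netM.
  have [c1 c10 E1] := IH1 net1; have [c2 c20 E2] := IH2 net2.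
  have [_ b1] := coef0_frac_gen M1; have [_ b2] := coef0_frac_gen M2.
  rewrite [constitutive _ _]/= E1 E2.
  exact: (parallel_equation (zero_root M1) (zero_root M2) _ _ c10 c20 b1 b2 cop).
- have /and3P[net1 net2 _] := netM; have /and3P[_ _ cop] := frac_generic netM.
  have [c1 c10 E1] := IH1 net1; have [c2 c20 E2] := IH2 net2.
  have [b1 _] := coef0_frac_gen M1; have [b2 _] := coef0_frac_gen M2.
  rewrite [constitutive _ _]/= E1 E2.
  exact: (series_equation (zero_root M1) (zero_root M2) _ _ c10 c20 b1 b2 cop).
Qed.
End Link.

Definition monic_coef (T : nzRingType) (s : side) (p q : {poly T}) : T :=
  match s with Strain => lead_coef p | Stress => lead_coef q end.

Definition other_coefs (T : nzRingType) (s : side) (p q : {poly T}) : seq T :=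
  match s with
  | Strain => take (size p).-1 p ++ q
  | Stress => (p : seq T) ++ take (size q).-1 q
  end.

(** * The list of non-monic coefficients *)

Section NonmonicList.
Variable L : fieldType.
Implicit Types p q : {poly L}.

Lemma polyseq_scale (k : L) p : k != 0 -> (k *: p : seq L) = [seq k * x | x <- p].
Proof.
move=> k0; apply: (@eq_from_nth _ 0); first by rewrite size_map size_scale.
by move=> i; rewrite size_scale// => ip; rewrite coefZ (nth_map 0).
Qed.

Lemma polyseq_shift_scale (k : L) (z : bool) p : k != 0 -> p != 0 ->
  (k *: ('X^z * p) : seq L) = nseq z 0 ++ [seq k * x | x <- p].
Proof.
move=> k0 p0; rewrite polyseq_scale//; case: z; rewrite ?expr0 ?mul1r//.
by rewrite expr1 mulrC polyseqMX//= mulr0.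
Qed.

Lemma filter_nz (k : L) (r : seq L) : k != 0 -> all (fun x => x != 0) r ->
  [seq x <- [seq k * x | x <- r] | x != 0] = [seq k * x | x <- r].
Proof.
move=> k0 /allP r0; apply/all_filterP/allP => _ /mapP[x xr ->].
by rewrite mulf_neq0// r0.
Qed.

Lemma filter_shift_scale (k : L) (z : bool) p : k != 0 -> p != 0 ->
  all (fun x => x != 0) p ->
  [seq x <- (k *: ('X^z * p) : seq L) | x != 0] = [seq k * x | x <- p] /\
  [seq x <- take (size (k *: ('X^z * p))).-1 (k *: ('X^z * p)) | x != 0] =
    [seq k * x | x <- take (size p).-1 p].
Proof.
move=> k0 p0 nz; rewrite polyseq_shift_scale// filter_cat filter_nz//.
have -> : [seq x <- nseq z (0 : L) | x != 0] = [::] by case: z; rewrite //= eqxx.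
split=> //; rewrite size_cat size_nseq size_map take_cat size_nseq.
have sp : (0 < size p)%N by rewrite lt0n size_poly_eq0.
have -> : ((z + size p).-1 < z)%N = false by apply/negbTE; rewrite -leqNgt; case: z; lia.
have -> : ((z + size p).-1 - z = (size p).-1)%N by case: z; lia.
rewrite filter_cat -map_take filter_nz; first by case: z; rewrite //= eqxx.
  by [].
by apply/allP => x /mem_take; exact: (allP nz).
Qed.

(** The filter removes only the zero coefficient created by X^z, and normalization cancels [c]. *)
Lemma nonmonic_list (s : side) (z : bool) (c : L) p q : c != 0 -> p != 0 -> q != 0 ->
  all (fun x => x != 0) p -> all (fun x => x != 0) q ->
  (let a := match s with Strain => lead_coef (c *: ('X^z * p))
                       | Stress => lead_coef (c *: q) end in
   let l := a^-1 *: (c *: ('X^z * p)) in let l' := a^-1 *: (c *: q) in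
   [seq a <- match s with
             | Strain => take (size l).-1 l ++ (l' : seq L)
             | Stress => (l : seq L) ++ take (size l').-1 l'
             end | a != 0]) =
  [seq (monic_coef s p q)^-1 * x | x <- other_coefs s p q].
Proof.
move=> c0 p0 q0 nzp nzq.
have a0 : monic_coef s p q != 0 by case: (s); rewrite lead_coef_eq0.
have aE : match s with Strain => lead_coef (c *: ('X^z * p))
                     | Stress => lead_coef (c *: q) end = c * monic_coef s p q.
  by case: (s); rewrite /= lead_coefZ// lead_coefM lead_coefXn mul1r.
have aV : (c * monic_coef s p q)^-1 * c = (monic_coef s p q)^-1.
  by rewrite invfM mulrAC mulVf// mul1r.
rewrite [LHS]/= aE !scalerA aV.
have k0 : (monic_coef s p q)^-1 != 0 by rewrite invr_eq0.
have [F1 F2] := filter_shift_scale z k0 p0 nzp.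
have [G1 G2] := filter_shift_scale false k0 q0 nzq.
rewrite expr0 mul1r in G1 G2.
by case: s F1 F2 G1 G2 {a0 aE aV k0} => F1 F2 G1 G2; rewrite filter_cat ?F1 ?F2 ?G1 ?G2
   /other_coefs map_cat.
Qed.
End NonmonicList.

Section CoefMap.
Variables (R : realType) (N K : nat).
Implicit Types (M : tree N K) (th : 'rV[R]_(N + K)) (s : side).

Local Notation A := (mpoly (N + K) R).
Local Notation F := (ratfun R N K).

Definition monic_gen M s : A :=
  monic_coef s (gen (@poly_env R N K) M).1 (gen (@poly_env R N K) M).2.

Definition other_gen M s : seq A :=
  other_coefs s (gen (@poly_env R N K) M).1 (gen (@poly_env R N K) M).2.

Lemma polyseq_map_tofrac (p : {poly A}) :
  (map_poly (@tofrac A) p : seq F) = [seq tofrac x | x <- p].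
Proof.
have inj : injective (@tofrac A) by move=> x y /eqP; rewrite tofrac_eq => /eqP.
apply: (@eq_from_nth _ 0).
  by rewrite size_map (size_map_inj_poly inj)// tofrac0.
move=> i; rewrite (size_map_inj_poly inj) ?tofrac0// => ip.
by rewrite (nth_map 0)// coef_map.
Qed.

Lemma size_others M s : size (other_gen M s) = num_coef M.
Proof.
have [s1 s2] := size_gen_poly R M.
rewrite /other_gen /num_coef; case: s; rewrite /= size_cat size_take s1 s2 /=.
  by rewrite ltnSn addnS.
by rewrite ltnSn addSn.
Qed.

Lemma nonmonic_coefsE M s : is_network M ->
  nonmonic_coefs R s M = [seq tofrac x / tofrac (monic_gen M s) | x <- other_gen M s].
Proof.
move=> netM; have [c c0 E] := constitutive_gen R netM.
have inj : injective (@tofrac A) by move=> x y /eqP; rewrite tofrac_eq => /eqP.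
have [a0 b0] := coef0_frac_gen R M.
have [p0 q0] : (gen (@frac_env R N K) M).1 != 0 /\ (gen (@frac_env R N K) M).2 != 0.
  by split; [apply: contraNneq a0 => ->|apply: contraNneq b0 => ->]; rewrite coef0.
have [s1 s2] := size_gen_poly R M.
have [nz1 nz2] : all (fun x => x != 0) (gen (@frac_env R N K) M).1 /\
    all (fun x => x != 0) (gen (@frac_env R N K) M).2.
  rewrite frac_gen /= !polyseq_map_tofrac !all_map.
  split; apply/allP => _ /(nthP 0)[i + <-] /=; rewrite tofrac_eq0.
    by rewrite s1 ltnS => /((coef_gen_neq0 R M i).1).
  by rewrite s2 ltnS => /((coef_gen_neq0 R M i).2).
have := @nonmonic_list _ s (zero_root M) c _ _ c0 p0 q0 nz1 nz2.
rewrite /nonmonic_coefs /normalized E => H.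
apply: (etrans H); rewrite frac_gen /map_pair [(_, _).1]/= [(_, _).2]/=.
have -> : monic_coef s (map_poly (@tofrac A) (gen (@poly_env R N K) M).1)
    (map_poly (@tofrac A) (gen (@poly_env R N K) M).2) = tofrac (monic_gen M s).
  by rewrite /monic_gen; case: (s); rewrite /monic_coef lead_coef_map_inj// tofrac0.
have -> : other_coefs s (map_poly (@tofrac A) (gen (@poly_env R N K) M).1)
    (map_poly (@tofrac A) (gen (@poly_env R N K) M).2) = map (@tofrac A) (other_gen M s).
  rewrite /other_gen; case: (s); rewrite /other_coefs !polyseq_map_tofrac map_cat map_take;
  by rewrite size_map.
rewrite -map_comp; apply: eq_map => x.
exact: mulrC.
Qed.

Lemma monic_gt0 M s th : param_space th -> 0 < meval (th 0) (monic_gen M s).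
Proof. by move=> /(lead_gen_gt0 M)[? ?]; case: s. Qed.

Lemma coef_mapE M s th i : is_network M -> param_space th ->
  Defs.coef_map s M th 0 i =
    meval (th 0) (other_gen M s)`_i / meval (th 0) (monic_gen M s).
Proof.
move=> netM th0; rewrite /Defs.coef_map mxE nonmonic_coefsE//.
have ilt : (i < size (other_gen M s))%N.
  by rewrite -(size_map (fun x => tofrac x / tofrac (monic_gen M s)) (other_gen M s))
             -nonmonic_coefsE.
rewrite (nth_map 0)//; apply: ratfun_evalE.
by rewrite gt_eqF// monic_gt0.
Qed.

Lemma num_nonmonicE M s : is_network M -> num_nonmonic R s M = num_coef M.
Proof.
by move=> netM; rewrite /num_nonmonic nonmonic_coefsE// size_map size_others.
Qed.

Lemma mem_others M s x : x \in other_gen M s ->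
  exists i, x = (gen (@poly_env R N K) M).1`_i \/ x = (gen (@poly_env R N K) M).2`_i.
Proof.
rewrite /other_gen; case: s; rewrite /other_coefs mem_cat => /orP[].
- by move=> /mem_take/(nthP 0)[i _ <-]; exists i; left.
- by move=> /(nthP 0)[i _ <-]; exists i; right.
- by move=> /(nthP 0)[i _ <-]; exists i; left.
- by move=> /mem_take/(nthP 0)[i _ <-]; exists i; right.
Qed.

Lemma coef_others M s i (x : A) :
  x = (gen (@poly_env R N K) M).1`_i \/ x = (gen (@poly_env R N K) M).2`_i ->
  [\/ x = 0, x = monic_gen M s | x \in other_gen M s].
Proof.
have split_nth (p : {poly A}) :
    [\/ p`_i = 0, p`_i = lead_coef p | p`_i \in take (size p).-1 p].
  have [ip|ip|ip] := ltngtP i (size p).-1.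
  - apply: Or33; rewrite -(nth_take 0 ip); apply: mem_nth.
    by rewrite size_take; case: ifP => // _; exact: leq_trans ip (leq_pred _).
  - by apply: Or31; rewrite nth_default// (leq_trans (leqSpred _) ip).
  - by apply: Or32; rewrite lead_coefE ip.
have all_nth (p : {poly A}) : p`_i = 0 \/ p`_i \in (p : seq A).
  have [ip|ip] := ltnP i (size p); first by right; exact: mem_nth.
  by left; rewrite nth_default.
rewrite /other_gen /monic_gen; case: s; rewrite /other_coefs /monic_coef => -[] ->;
  rewrite mem_cat.
- have [->|->|->] := split_nth (gen (@poly_env R N K) M).1;
    [exact: Or31|exact: Or32|exact: Or33].
- by have [->|->] := all_nth (gen (@poly_env R N K) M).2;
    [exact: Or31|apply: Or33; rewrite orbT].
- by have [->|->] := all_nth (gen (@poly_env R N K) M).1;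
    [exact: Or31|apply: Or33].
- by have [->|->|->] := split_nth (gen (@poly_env R N K) M).2;
    [exact: Or31|exact: Or32|apply: Or33; rewrite orbT].
Qed.

(** Equal normalized coefficients make the pairs proportional by the ratio of the monic
    coefficients; conversely a common scalar cancels in every quotient. *)
Lemma coef_map_eq M s th th' : is_network M -> param_space th -> param_space th' ->
  Defs.coef_map s M th' = Defs.coef_map s M th <->
  proportional (gen (env th') M) (gen (env th) M).
Proof.
move=> netM th0 th'0.
have l0 := monic_gt0 M s th0; have l'0 := monic_gt0 M s th'0.
split=> [E|[c c0 E]].
  have valE x : x \in other_gen M s ->
      meval (th' 0) x / meval (th' 0) (monic_gen M s) =
      meval (th 0) x / meval (th 0) (monic_gen M s).
    move=> /(nthP 0)[i + <-]; rewrite size_others -(num_nonmonicE s)// => il.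
    by have /rowP/(_ (Ordinal il)) := E; rewrite !coef_mapE.
  have coefE i x : x = (gen (@poly_env R N K) M).1`_i \/
      x = (gen (@poly_env R N K) M).2`_i ->
      meval (th' 0) x =
      meval (th' 0) (monic_gen M s) / meval (th 0) (monic_gen M s) * meval (th 0) x.
    move=> /(coef_others s)[->|->|/valE H]; first by rewrite !meval0 mulr0.
      by rewrite divfK// gt_eqF.
    by rewrite mulrAC -mulrA -H mulrC divfK// gt_eqF.
  exists (meval (th' 0) (monic_gen M s) / meval (th 0) (monic_gen M s)).
    by apply: mulf_neq0; rewrite ?invr_eq0 gt_eqF.
  rewrite [LHS]surjective_pairing /scale; congr pair; apply/polyP => i; rewrite coefZ.
    by rewrite -!(coef_gen_meval _ M i).1 (coefE i)//; left.
  by rewrite -!(coef_gen_meval _ M i).2 (coefE i)//; right.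
have mevE i x : x = (gen (@poly_env R N K) M).1`_i \/
    x = (gen (@poly_env R N K) M).2`_i -> meval (th' 0) x = c * meval (th 0) x.
  case=> ->; first by rewrite !(coef_gen_meval _ M i).1 E coefZ.
  by rewrite !(coef_gen_meval _ M i).2 E coefZ.
have lE : meval (th' 0) (monic_gen M s) = c * meval (th 0) (monic_gen M s).
  by rewrite /monic_gen; case: (s); apply: mevE; rewrite /= lead_coefE; [left|right].
apply/rowP => i; rewrite !coef_mapE// lE.
have [|] := mem_others (M := M) (s := s) (x := (other_gen M s)`_i).
  by apply: mem_nth; rewrite size_others -(num_nonmonicE s).
by move=> j /mevE ->; rewrite -mulf_div divff ?mul1r.
Qed.
End CoefMap.

(** * Parameter count and local identifiability *)

Lemma finite_on_finite (R : realType) N K (P : seq ('I_N + 'I_K))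
    (S : set 'rV[R]_(N + K)) : (forall p, p \in P) -> finite_on P S -> finite_set S.
Proof.
move=> Pall [t tP]; apply: (@sub_finite_set _ _ [set` t]); last exact: finite_seq.
move=> th /tP[w wt thw] /=; suff -> : th = w by [].
apply/rowP => i; have := thw (fintype.split i) (Pall _).
by rewrite /env splitK.
Qed.

Lemma size_params N K (M : tree N K) :
  network_with M -> size (params M) = (N + K)%N.
Proof.
move=> [netM allM].
have un : uniq (params M).
  elim/conn_ind: M netM {allM} => // b M1 M2 IH1 IH2.
  rewrite is_network_conn params_conn cat_uniq => /and3P[/IH1 -> /IH2 -> /=].
  by rewrite andbT.
rewrite -(card_uniqP un) -[in RHS](card_ord N) -[in RHS](card_ord K) -card_sum.
by apply: eq_card => p; rewrite allM.
Qed.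

Theorem theorem2 (R : realType) (N K : nat) (M : tree N K) (s : side)
  (hM : network_with M) :
  locally_identifiable R s M <-> num_nonmonic R s M = (N + K)%N.
Proof.
have [netM allM] := hM; have sizeM := size_params hM.
rewrite num_nonmonicE// -sizeM.
pose q := disc (@poly_env R N K) M.
have NK0 : (0 < N + K)%N by rewrite -sizeM; exact: leq_trans (num_coef_le M).
have fiberE th : param_space th -> fiber s M th = same_eqn M th.
  move=> th0; apply/seteqP; split=> th' [th'0 E]; split=> //.
    exact/(coef_map_eq s netM th0 th'0).
  exact/(coef_map_eq s netM th0 th'0).
have q0 : lebesgue_null [set th : 'rV[R]_(N + K) | meval (th 0) q = 0].
  exact: null_mpoly_zero NK0 (disc_poly_neq0 R netM).
split=> [ident|nM].
  apply/eqP; apply: contrapT => /negP nM.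
  have infinite th : param_space th -> meval (th 0) q != 0 ->
      ~ finite_set (fiber s M th).
    move=> th0; rewrite disc_meval// fiberE// => gen_th fin.
    apply: (infinite_same_eqn netM th0 gen_th nM).
    by apply: sub_finite_set fin => th' [].
  (* If identifiable, the set of infinite fibers together with the zero set of [q] would be null,
     yet it contains the cube [1, 2]^(N+K). *)
  have : lebesgue_null ([set th : 'rV[R]_(N + K) | param_space th /\
      ~ finite_set (fiber s M th)] `|` [set th | meval (th 0) q = 0]).
    exact: lebesgue_nullU.
  apply: cube_not_null => th th12.
  have th0 : param_space th.
    by move=> i; have /andP[+ _] := th12 i; exact: lt_le_trans.
  have [?|qth] := eqVneq (meval (th 0) q) 0; first by right.
  by left; split=> //; exact: infinite.
(* All infinite fibers lie over the null zero set of [q]: elsewhere the parameters are generic, the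
   equation is coprime and its fiber finite. *)
apply: sub_null q0 => th [th0 inf]; apply: contrapT => /eqP qth; apply: inf.
rewrite fiberE//; apply: (finite_on_finite allM).
apply: finite_same_eqn => //; apply: coprime_gen; first exact: env_gt0.
by rewrite -disc_meval.
Qed.
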